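(* For every $d\ge1$ there is a constant $C(d)>0$ depending only on $d$ such that the following holds. Let $h$ be a monotone (increasing or decreasing) transformation, let $p=h\circ g\in\mathcal P(h)$ be a convex-transformed density on a subset of $\mathbb R^d$, and let $x_0\in\operatorname{ri}(\operatorname{dom} g)$ be a point such that $h$ is continuously differentiable at $g(x_0)$, $h\circ g(x_0)>0$, $h'\circ g(x_0)\ne0$ and $\operatorname{curv}_{x_0}g>0$. Then, for the functional $T(h\circ g):=g(x_0)$, there exists a sequence $\{p_n\}\subset\mathcal P(h)$ such that $$\liminf_{n\to\infty} n^{2/(d+4)}R_1(n;T,\{h\circ g,p_n\})\ \ge\ C(d)\left[\frac{(h\circ g(x_0))^2\,\operatorname{curv}_{x_0}g}{(h'\circ g(x_0))^4}\right]^{1/(d+4)}.$$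
   Context: Write $\overline{\mathbb R}=[-\infty,+\infty]$, and let $a\asymp b$ mean that $a/b$ is bounded above and bounded away from $0$ in the indicated limit. An increasing transformation is a nondecreasing $h:\overline{\mathbb R}\to[0,+\infty]$ with $h(-\infty)=0$, $h(+\infty)=+\infty$; put $y_0=\inf\{y:h(y)>0\}<y_\infty=\sup\{y:h(y)<\infty\}$. It is assumed that $h(y)=o(|y|^{-\alpha})$ as $y\to-\infty$ for some $\alpha>d$; that $h(y)\asymp(y_\infty-y)^{-\beta}$ as $y\uparrow y_\infty$ for some $\beta>d$ if $y_\infty<\infty$; and that $h$ is continuously differentiable on $(y_0,y_\infty)$. Then $\mathcal P(h)$ is the family of bounded densities on $[0,\infty)^d$ of the form $h\circ g$ with $g$ closed proper convex and $\operatorname{dom}g=[0,\infty)^d$. A decreasing transformation is a nonincreasing $h:\overline{\mathbb R}\to[0,+\infty]$ with $h(-\infty)=+\infty$, $h(+\infty)=0$; put $y_0=\sup\{y:h(y)>0\}>y_\infty=\inf\{y:h(y)<\infty\}$. It is assumed that $h(y)=o(y^{-\alpha})$ as $y\to+\infty$ for some $\alpha>d$; that $h(y)\asymp(y-y_\infty)^{-\beta}$ as $y\downarrow y_\infty$ for some $\beta>d$ if $y_\infty>-\infty$; that $h(y)^\gamma h(-Cy)=o(1)$ as $y\to-\infty$ for some $\gamma,C>0$ if $y_\infty=-\infty$; and that $h$ is continuously differentiable on $(y_\infty,y_0)$. Then $\mathcal P(h)$ is the family of bounded densities on $\mathbb R^d$ of the form $h\circ g$ with $g:\mathbb R^d\to(-\infty,+\infty]$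 closed proper convex and $\dim(\operatorname{dom}g)=d$. ''Continuously differentiable at a point'' means continuously differentiable in a neighborhood of it. Minimax risk: for a class $\mathcal Q$ of densities and a real functional $T$ on $\mathcal Q$, $R_1(n;T,\mathcal Q)=\inf_{t_n}\sup_{q\in\mathcal Q}\mathbb E_{q^{\times n}}|t_n(X_1,\dots,X_n)-Tq|$, where $t_n$ ranges over all estimators (measurable functions of $X_1,\dots,X_n$) and $X_1,\dots,X_n$ are i.i.d. with density $q$ under $\mathbb E_{q^{\times n}}$. If $q=h\circ f$ is an element of $\mathcal P(h)$ then $Tq=f(x_0)$. Curvature: for a positive definite $d\times d$ matrix $G$, a convex function $g$ is locally $G$-strongly convex at $x_0$ if there is a neighborhood $O(x_0)$ of $x_0$ and a convex function $q$ with $g(x)=\frac12(x-x_0)^TG(x-x_0)+q(x)$ on $O(x_0)$. Let $\mathcal{SC}(g;x_0)$ be the set of all such $G$. Then $\operatorname{curv}_{x_0}g=\sup\{\det G: G\in\mathcal{SC}(g;x_0)\}$, equal to $0$ if $\mathcal{SC}(g;x_0)$ is empty. (If $g$ is $C^2$ at $x_0$ with positive definite Hessian, then $\operatorname{curv}_{x_0}g=\det\nabla^2g(x_0)$.) *)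

(* Defs.v *)
From HB Require Import structures.
From mathcomp Require Import all_boot all_order all_algebra.
From mathcomp Require Import all_classical all_reals all_analysis.

Set Implicit Arguments.
Unset Strict Implicit.
Unset Printing Implicit Defensive.

Import Order.TTheory GRing.Theory Num.Theory.
Import numFieldNormedType.Exports.

Local Open Scope classical_set_scope.
Local Open Scope ring_scope.

Section power_measure.
Context (dsp : measure_display) (T : measurableType dsp) (R : realType).

Definition cons_pair n (z : T * n.-tuple T) : n.+1.-tuple T :=
  [tuple of z.1 :: z.2].

Lemma measurable_cons_pair n : measurable_fun setT (@cons_pair n).
Proof. exact: measurable_cons. Qed.

Lemma measurable_uncons n :
  measurable_fun setT (fun t : n.+1.-tuple T => (thead t, [tuple of behead t])).
Proof.
by apply/measurable_fun_pair; [exact: measurable_tnth|exact: measurable_behead].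
Qed.

Section power_measureS.
Variables (mu : {sigma_finite_measure set T -> \bar R}) (n : nat).
Variable nu : {sigma_finite_measure set (n.-tuple T) -> \bar R}.

Definition power_measureS : set (n.+1.-tuple T) -> \bar R :=
  pushforward (mu \x nu)%E (@cons_pair n).

Let power_measureS0 : power_measureS set0 = 0%E.
Proof. by rewrite /power_measureS /pushforward preimage_set0 measure0. Qed.

Let power_measureS_ge0 A : (0 <= power_measureS A)%E.
Proof. by rewrite /power_measureS /pushforward measure_ge0. Qed.

Let power_measureS_sigma_additive : semi_sigma_additive power_measureS.
Proof.
exact: (@measure_semi_sigma_additive _ _ _
  (measure_function_pushforward__canonical__measure_function_Measure
    (mu \x nu)%E (@measurable_cons_pair n))).
Qed.

HB.instance Definition _ := isMeasure.Build _ _ _ power_measureS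
  power_measureS0 power_measureS_ge0 power_measureS_sigma_additive.

Let power_measureS_sigma_finite : sigma_finite setT power_measureS.
Proof.
have /sigma_finiteP[F [TF ndF Foo]] := sigma_finiteT mu.
have /sigma_finiteP[G [TG ndG Goo]] := sigma_finiteT nu.
pose uncons (t : n.+1.-tuple T) := (thead t, [tuple of behead t]).
exists (fun k => uncons @^-1` (F k `*` G k)).
  rewrite -preimage_bigcup (_ : \bigcup_i _ = setT) ?preimage_setT//.
  rewrite -setXTT TF TG predeqE => -[x y]; split.
    by move=> [n' _ []/= ? ?]; split; exists n'.
  move=> [/= [i _ Fix] [k _ Gky]]; exists (maxn i k) => //; split.
  - by move: x Fix; exact/subsetPset/ndF/leq_maxl.
  - by move: y Gky; exact/subsetPset/ndG/leq_maxr.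
move=> k; have [? ?] := Foo k; have [? ?] := Goo k; split.
  rewrite -[X in measurable X]setTI; apply: measurable_uncons => //.
  exact: measurableX.
rewrite /power_measureS /pushforward -comp_preimage.
rewrite (_ : uncons \o @cons_pair n = id).
  by rewrite preimage_id product_measure1E// lte_mul_pinfty// ge0_fin_numE.
by apply/funext => -[x t]; congr pair; exact/val_inj.
Qed.

HB.instance Definition _ := Measure_isSigmaFinite.Build _ _ _ power_measureS
  power_measureS_sigma_finite.

End power_measureS.

(* The n-fold product mu \x ... \x mu; the 0-fold one is the point mass at the
   empty tuple *)
Fixpoint power_measure (mu : {sigma_finite_measure set T -> \bar R}) (n : nat) :
    {sigma_finite_measure set (n.-tuple T) -> \bar R} :=
  if n is m.+1 then power_measureS mu (power_measure mu m)
  else \d_([tuple] : 0.-tuple T).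

End power_measure.

(* Points of R^d are row vectors 'rV[R]_d for the algebra and the topology; the
   measure theory lives on d.-tuples, which carry the product sigma-algebra. *)
Section euclidean_measure.
Context (R : realType) (d : nat).

Definition row_of (x : d.-tuple (measurableTypeR R)) : 'rV[R]_d :=
  \row_i tnth x i.

Definition lebesgue_measureX :
    {sigma_finite_measure set (d.-tuple (measurableTypeR R)) -> \bar R} :=
  power_measure (@lebesgue_measure R) d.

Definition density (q : 'rV[R]_d -> R) : Prop :=
  [/\ measurable_fun setT (q \o row_of), (forall x, 0 <= q x) &
      (\int[lebesgue_measureX]_x (q (row_of x))%:E = 1)%E].

(* E_{q^n}[F(X_1, ..., X_n)] *)
Definition iid_expectation (n : nat) (q : 'rV[R]_d -> R)
    (F : n.-tuple (d.-tuple (measurableTypeR R)) -> R) : \bar R :=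
  (\int[power_measure lebesgue_measureX n]_x
     ((\prod_(i < n) q (row_of (tnth x i))) * F x)%:E)%E.

Definition minimax_risk (n : nat) (T : ('rV[R]_d -> R) -> R)
    (Q : set ('rV[R]_d -> R)) : \bar R :=
  ereal_inf [set ereal_sup [set iid_expectation q (fun x => `|t x - T q|)
                           | q in Q]
            | t in [set t : n.-tuple (d.-tuple (measurableTypeR R)) -> R
                   | measurable_fun setT t]].

End euclidean_measure.

Section convex_analysis.
Context (R : realType) (d : nat).
Implicit Types (f g : 'rV[R]_d -> \bar R) (A : set 'rV[R]_d) (x : 'rV[R]_d).

Definition dom f : set 'rV[R]_d := [set x | (f x < +oo)%E].

Definition epigraph f : set ('rV[R]_d * R^o) :=
  [set z | (f z.1 <= (z.2 : R)%:E)%E].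

Definition econvex f : Prop :=
  convex_set (epigraph f : set (convex_lmodType ('rV[R]_d * R^o)%type)).

Definition proper f : Prop := (forall x, f x != -oo%E) /\ dom f !=set0.

(* For a proper convex function, being closed is being lower semicontinuous. *)
Definition closed_proper_convex f : Prop :=
  [/\ econvex f, proper f & lower_semicontinuous f].

Definition affine_set A : Prop :=
  forall x y (t : R), A x -> A y -> A (t *: x + (1 - t) *: y).

Definition affine_hull A : set 'rV[R]_d :=
  \bigcap_(B in [set B | affine_set B /\ A `<=` B]) B.

Definition has_affine_dim A (k : nat) : Prop :=
  exists x (V : {vspace 'rV[R]_d}),
    affine_hull A = [set y | y - x \in V] /\ \dim V = k.

Definition relint A : set 'rV[R]_d :=
  [set x | A x /\ \forall y \near x, affine_hull A y -> A y].

Definition orthant : set 'rV[R]_d := [set x | forall i, 0 <= x ord0 i].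

Definition quad_form (G : 'M[R]_d) (v : 'rV[R]_d) : R :=
  (v *m G *m v^T) ord0 ord0.

Definition posdefmx (G : 'M[R]_d) : Prop :=
  G^T = G /\ forall v, v != 0 -> 0 < quad_form G v.

Definition locally_strongly_convex (G : 'M[R]_d) g x0 : Prop :=
  exists q : 'rV[R]_d -> \bar R, econvex q /\
    \forall x \near x0, g x = ((2^-1 * quad_form G (x - x0))%:E + q x)%E.

Definition SC g x0 : set 'M[R]_d :=
  [set G | posdefmx G /\ locally_strongly_convex G g x0].

(* The supremum may be +oo, e.g. for |x| `^ (3/2) at 0. *)
Definition curv g x0 : \bar R :=
  if `[< SC g x0 !=set0 >] then ereal_sup [set (\det G)%:E | G in SC g x0]
  else 0%E.

End convex_analysis.

Section transformations.
Context (R : realType).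
Implicit Types (h : \bar R -> \bar R) (a : R -> \bar R) (b : R -> R).

Definition elittleo (F : set_system R) a b : Prop :=
  forall e, 0 < e -> \forall y \near F, (`|a y| <= (e * `|b y|)%:E)%E.

(* Only used with b > 0. *)
Definition easymp (F : set_system R) a b : Prop :=
  exists c C : R, [/\ 0 < c, 0 < C &
    \forall y \near F, ((c * b y)%:E <= a y <= (C * b y)%:E)%E].

Definition fin_part h : R -> R := fun y => fine (h y%:E).

Definition C1_at h (y : R) : Prop :=
  \forall z \near y, [/\ h z%:E \is a fin_num, derivable (fin_part h) z 1 &
                         {for z, continuous (derive1 (fin_part h) : R -> R)}].

Inductive monotonicity := Increasing | Decreasing.

Definition incr_y0 h : \bar R := ereal_inf [set y | (0 < h y)%E].
Definition incr_yoo h : \bar R := ereal_sup [set y | (h y < +oo)%E].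
Definition decr_y0 h : \bar R := ereal_sup [set y | (0 < h y)%E].
Definition decr_yoo h : \bar R := ereal_inf [set y | (h y < +oo)%E].

Record increasing_transformation (d : nat) h : Prop := {
  incr_ge0 : forall y, (0 <= h y)%E;
  incr_mono : {homo h : x y / (x <= y)%E};
  incr_Noo : h -oo%E = 0%E;
  incr_oo : h +oo%E = +oo%E;
  incr_y0_lt_yoo : (incr_y0 h < incr_yoo h)%E;
  incr_tail : exists2 al : R, d%:R < al &
    elittleo (ninfty_nbhs R) (fun y => h y%:E) (fun y => `|y| `^ (- al));
  incr_blowup : forall yoo : R, incr_yoo h = yoo%:E ->
    exists2 be : R, d%:R < be &
      easymp yoo^'- (fun y => h y%:E) (fun y => (yoo - y) `^ (- be));
  incr_C1 : forall y : R, (incr_y0 h < y%:E < incr_yoo h)%E -> C1_at h y }.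

Record decreasing_transformation (d : nat) h : Prop := {
  decr_ge0 : forall y, (0 <= h y)%E;
  decr_mono : {homo h : x y /~ (x <= y)%E};
  decr_Noo : h -oo%E = +oo%E;
  decr_oo : h +oo%E = 0%E;
  decr_yoo_lt_y0 : (decr_yoo h < decr_y0 h)%E;
  decr_tail : exists2 al : R, d%:R < al &
    elittleo (pinfty_nbhs R) (fun y => h y%:E) (fun y => y `^ (- al));
  decr_blowup : forall yoo : R, decr_yoo h = yoo%:E ->
    exists2 be : R, d%:R < be &
      easymp yoo^'+ (fun y => h y%:E) (fun y => (y - yoo) `^ (- be));
  decr_growth : decr_yoo h = -oo%E ->
    exists ga C : R, [/\ 0 < ga, 0 < C &
      elittleo (ninfty_nbhs R) (fun y => (h y%:E `^ ga * h (- C * y)%:E)%E)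
        (fun=> 1)];
  decr_C1 : forall y : R, (decr_yoo h < y%:E < decr_y0 h)%E -> C1_at h y }.

Definition transformation (m : monotonicity) (d : nat) h : Prop :=
  match m with
  | Increasing => increasing_transformation d h
  | Decreasing => decreasing_transformation d h
  end.

End transformations.

Section transformed_class.
Context (R : realType) (d : nat).
Implicit Types (m : monotonicity) (h : \bar R -> \bar R).
Implicit Types (f : 'rV[R]_d -> \bar R) (q : 'rV[R]_d -> R).

Definition density_domain m : set 'rV[R]_d :=
  match m with Increasing => @orthant R d | Decreasing => setT end.

Definition admissible m f : Prop :=
  closed_proper_convex f /\
  match m with
  | Increasing => dom f = @orthant R d
  | Decreasing => has_affine_dim (dom f) d
  end.

(* q = h \o f is an element of P(h); a density on the orthant is extended by 0 *)
Definition represents m h f q : Prop :=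
  [/\ admissible m f,
      (forall x, density_domain m x -> (q x)%:E = h (f x)),
      (forall x, ~ density_domain m x -> q x = 0),
      density q
    & exists M : R, forall x, q x <= M].

Definition Pclass m h : set ('rV[R]_d -> R) :=
  [set q | exists f, represents m h f q].

(* T (h \o f) = f x0 for every element h \o f of P(h) belonging to Q; it forces
   the real number f x0 to be determined by h \o f *)
Definition evaluation_on m h (x0 : 'rV[R]_d) (Q : set ('rV[R]_d -> R))
    (T : ('rV[R]_d -> R) -> R) : Prop :=
  forall q f, Q q -> represents m h f q -> f x0 = (T q)%:E.

End transformed_class.

(* Main.v *)
(** Near [x0] write [g = N^2 / 2 + q] with [N x = quad_norm G (x - x0)] and [q] convex.
    For small [0 <= del <= e] the function [N^2 / 2] is replaced by
    [max (N^2 / 2 - del, r N - r^2 / 2 + ((N - r)_+)^2 / 2, e)], a convex nondecreasing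
    function of the norm [N] which equals [N^2 / 2] for [N >= r] and [e] at [x0]. This
    raises [g] by at most [e] on the ellipsoid [N^2 <= 2 e], lowers it by at most [del]
    on [N <= r], and keeps it convex. Monotonicity of [h] and the intermediate value
    theorem give a [del] of order [e^(1 + d/2)] for which the new function again has
    total mass one. As the ellipsoid has volume of order [e^(d/2) / sqrt (det G)], the
    chi-square divergence from [p] is of order [h'^2 / h * e^(2 + d/2) / sqrt (det G)],
    so that [e^(d + 4)] of order [h^2 det G / (h'^4 n^2)] keeps the [n]-fold products
    close, and Le Cam's two-point inequality bounds the risk below by [e / 4]. It remains
    to let [det G] approach [curv g x0]; when this is infinite the alternatives are chosen
    by a diagonal argument. *)
Require Import Defs.
From mathcomp Require Import all_boot all_order all_algebra.
From mathcomp Require Import all_classical all_reals all_analysis.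
From mathcomp Require Import measurable_realfun ring lra.

Set Implicit Arguments.
Unset Strict Implicit.
Unset Printing Implicit Defensive.

Import Order.TTheory GRing.Theory Num.Theory.
Import numFieldNormedType.Exports.

Local Open Scope classical_set_scope.
Local Open Scope ring_scope.

(** * Product measures and volumes of ellipsoids *)

(** An alternative must stay inside the class, and a multiple of [h \o f] need not be of that form,
    so its mass cannot be restored by rescaling. The mass is corrected by lowering [g] on a fixed
    annulus, and it is the strong convexity at [x0] that leaves room for this. As the annulus does
    not shrink with [e], the shift [del] is smaller than [e] by a factor of order [e^(d/2)]. The
    correction therefore adds only order [e^(2 + d)] to the divergence, against [e^(2 + d/2)] from
    the raised part. Hence volumes that shrink with [e] need only upper bounds, and for the annulus
    any positive volume will do.

    Two further obstacles are that [g] is not assumed measurable and that [h] may be constant away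
    from [g x0]. Strict monotonicity of [h] near [g x0] settles both: it recovers [g] from [p] on
    the ellipsoid, and it makes the value at [x0] a function of the density alone. Convexity also
    has to be transferred from a neighbourhood of [x0], where the decomposition of [g] holds, to the
    whole space. *)

Lemma measurable_fun_invr_ge0 dsp (T : measurableType dsp) (R : realType) (f : T -> R) :
  measurable_fun setT f -> (forall x, 0 <= f x) ->
  measurable_fun setT (fun x => (f x)^-1).
Proof.
move=> mf f0; rewrite (_ : (fun _ => _) = (fun x => f x `^ (-1))).
  exact: (measurableT_comp (measurable_powR _) mf).
by apply/funext => x; rewrite powR_inv1.
Qed.

Section power_measure_integral.
Context (dsp : measure_display) (T : measurableType dsp) (R : realType).
Variable mu : {sigma_finite_measure set T -> \bar R}.
Local Open Scope ereal_scope.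

Lemma ge0_integral_power_measureS n (F : n.+1.-tuple T -> \bar R) :
  measurable_fun setT F -> (forall x, 0 <= F x) ->
  \int[power_measure mu n.+1]_x F x =
  \int[mu]_a \int[power_measure mu n]_t F (cons_pair (a, t)).
Proof.
move=> mF F0.
transitivity (\int[pushforward (mu \x power_measure mu n) (@cons_pair _ T n)]_x F x).
  by [].
rewrite (ge0_integral_pushforward (@measurable_cons_pair _ T n))//.
rewrite preimage_setT (fubini_tonelli1 (F \o @cons_pair _ T n))//.
- by apply: measurableT_comp => //; exact: measurable_cons_pair.
- by move=> z; exact: F0.
Qed.

Lemma ge0_integral_power_measureS_swap n (F : n.+1.-tuple T -> \bar R) :
  measurable_fun setT F -> (forall x, 0 <= F x) ->
  \int[power_measure mu n.+1]_x F x =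
  \int[power_measure mu n]_t \int[mu]_a F (cons_pair (a, t)).
Proof.
move=> mF F0; rewrite ge0_integral_power_measureS//.
apply: (fubini_tonelli (F \o @cons_pair _ T n)).
- by apply: measurableT_comp => //; exact: measurable_cons_pair.
- by move=> z; exact: F0.
Qed.

(** Tonelli peels off one coordinate at a time. Equal factors give the integral of an [n]-fold
    likelihood, indicators of intervals give the volume of a box. *)
Lemma integral_prod_power_measure n (f : 'I_n -> T -> R) (r : 'I_n -> R) :
  (forall i, measurable_fun setT (f i)) -> (forall i x, (0 <= f i x)%R) ->
  (forall i, \int[mu]_x (f i x)%:E = (r i)%:E) ->
  \int[power_measure mu n]_x (\prod_(i < n) f i (tnth x i))%:E =
  (\prod_(i < n) r i)%:E.
Proof.
have mprod k (f' : 'I_k -> T -> R) : (forall i, measurable_fun setT (f' i)) ->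
    measurable_fun setT
      (fun x : k.-tuple T => (\prod_(i < k) f' i (tnth x i))%R).
  move=> mf; apply: measurable_prod => i _; apply: measurableT_comp => //.
  exact: measurable_tnth.
elim: n f r => [|n IH] f r mf f0 fr.
  under eq_integral do rewrite big_ord0.
  by rewrite big_ord0 /= integral_cst//= diracT mul1e.
rewrite ge0_integral_power_measureS//; last 2 first.
- by apply/measurable_EFinP; exact: (mprod n.+1).
- by move=> x; rewrite lee_fin; exact: prodr_ge0.
pose f' i := f (lift ord0 i).
have f'0 (x : n.-tuple T) : (0 <= \prod_(i < n) f' i (tnth x i))%R.
  by apply: prodr_ge0 => i _; exact: f0.
have inner a : \int[power_measure mu n]_t
    (\prod_(i < n.+1) f i (tnth (cons_pair (a, t)) i))%:E =
    (\prod_(i < n) r (lift ord0 i))%:E * (f ord0 a)%:E.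
  rewrite -(IH f' _ (fun=> mf _) (fun i x => f0 _ x) (fun=> fr _)).
  rewrite muleC -ge0_integralZl//; last 3 first.
  - by apply/measurable_EFinP; apply: mprod => i; exact: mf.
  - by move=> t _; rewrite lee_fin f'0.
  - by rewrite lee_fin.
  apply: eq_integral => t _; rewrite big_ord_recl tnth0 EFinM; congr (_ * _%:E).
  by apply: eq_bigr => i _; rewrite tnthS.
under eq_integral do rewrite inner.
rewrite ge0_integralZl//=.
- by rewrite fr -EFinM big_ord_recl mulrC.
- exact/measurable_EFinP.
- by move=> a _; rewrite lee_fin.
- rewrite lee_fin; apply: prodr_ge0 => i _.
  by rewrite -lee_fin -fr; apply: integral_ge0 => x _; rewrite lee_fin.
Qed.

End power_measure_integral.

Section lebesgue_volume.
Context (R : realType).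

Lemma row_of_cons d (z : measurableTypeR R * d.-tuple (measurableTypeR R)) :
  row_of (cons_pair z) = row_mx (z.1)%:M (row_of z.2) :> 'rV[R]_(1 + d).
Proof.
apply/rowP => i; rewrite !mxE; case: (split_ordP i) => j ->.
  by rewrite [j]ord1 (_ : lshift d ord0 = ord0) ?tnth0 ?mxE//; exact/val_inj.
by rewrite (_ : rshift 1 j = lift ord0 j) ?tnthS ?mxE//; exact/val_inj.
Qed.

Lemma measurable_quad_form d (G : 'M[R]_d) (c : 'rV[R]_d) :
  measurable_fun setT (fun x : d.-tuple (measurableTypeR R) =>
    quad_form G (row_of x - c)).
Proof.
rewrite (_ : (fun _ => _) = (fun x : d.-tuple (measurableTypeR R) =>
  \sum_(j < d) (\sum_(i < d) (tnth x i - c ord0 i) * G i j) * (tnth x j - c ord0 j))).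
  apply: measurable_sum => j; apply: measurable_funM.
    apply: measurable_sum => i; apply: measurable_funM => //.
    by apply: measurable_funB => //; exact: measurable_tnth.
  by apply: measurable_funB => //; exact: measurable_tnth.
apply/funext => x; rewrite /quad_form mxE; apply: eq_bigr => j _.
by rewrite !mxE; congr (_ * _); apply: eq_bigr => i _; rewrite !mxE.
Qed.

(* Completing the square in the first coordinate. *)
Lemma quad_form_schur d (G : 'M[R]_(1 + d)) : posdefmx G ->
  exists (a : R) (b : 'cV[R]_d) (S : 'M[R]_d),
    [/\ 0 < a, posdefmx S, \det G = a * \det S &
        forall v : 'rV[R]_(1 + d), quad_form G v =
          a * (lsubmx v ord0 ord0 + (rsubmx v *m b) ord0 ord0) ^+ 2
          + quad_form S (rsubmx v)].
Proof.
move=> [Gsym Gpos].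
pose a := G (lshift d ord0) (lshift d ord0).
pose b := dlsubmx G.
have Gul : ulsubmx G = a%:M.
  by apply/matrixP => i j; rewrite !ord1 !mxE eqxx mulr1n.
have Gur : ursubmx G = b^T by rewrite /b trmx_dlsub Gsym.
pose S := drsubmx G - a^-1 *: (b *m b^T).
have Ssym : S^T = S.
  by rewrite /S linearB /= trmx_drsub Gsym linearZ/= trmx_mul trmxK.
have GE : G = block_mx a%:M b^T b (drsubmx G) by rewrite -Gul -Gur submxK.
have a0 : 0 < a.
  (* The test vector is the first basis vector, where the form takes the value [a]. *)
  have := Gpos (row_mx 1%:M 0).
  rewrite /quad_form GE mul_row_block tr_row_mx mul_row_col !mul0mx !addr0.
  rewrite trmx1 trmx0 mulmx0 addr0 mulmx1 mul1mx mxE eqxx mulr1n; apply.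
  apply/eqP => /(congr1 lsubmx); rewrite row_mxKl linear0 => /matrixP/(_ ord0 ord0).
  by rewrite !mxE eqxx => /eqP; rewrite oner_eq0.
have quadE (v : 'rV[R]_(1 + d)) : quad_form G v =
    a * (lsubmx v ord0 ord0 + (rsubmx v *m (a^-1 *: b)) ord0 ord0) ^+ 2
    + quad_form S (rsubmx v).
  rewrite -{1}[v]hsubmxK; set u := lsubmx v; set w := rsubmx v.
  have uE : u = (u ord0 ord0)%:M := mx11_scalar u.
  set t := u ord0 ord0 in uE *.
  rewrite /quad_form GE mul_row_block tr_row_mx mul_row_col uE.
  rewrite -!scalar_mxM tr_scalar_mx !mulmxDl.
  rewrite !mul_scalar_mx !mul_mx_scalar.
  rewrite /S mulmxBr mulmxBl -!scalemxAr -!scalemxAl !mulmxA.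
  have wb : b^T *m w^T = w *m b.
    by apply/matrixP => i j; rewrite !ord1 -trmx_mul !mxE.
  rewrite -(mulmxA (w *m b)) wb.
  rewrite !mxE big_ord1 !mxE.
  set s := \sum_j w ord0 j * b j ord0.
  set q := \sum_j _.
  rewrite eqxx mulr1n; field.
  by rewrite gt_eqF.
exists a, (a^-1 *: b), S; split => //.
- split => // w w0.
  (* The first coordinate is chosen to cancel the completed square, which leaves the value of [S] at
     [w]. *)
  have := Gpos (row_mx (- (w *m (a^-1 *: b))) w).
  rewrite quadE row_mxKl row_mxKr mxE addNr expr0n mulr0 add0r; apply.
  by apply: contra_neq w0 => /(congr1 rsubmx); rewrite row_mxKr linear0.
(* One step of Gaussian elimination; the left factor is unipotent, so it has determinant one. *)
- have LE : block_mx 1%:M 0 (- (a^-1 *: b)) 1%:M *m G = block_mx a%:M b^T 0 S.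
    rewrite {1}GE mulmx_block !mul1mx !mul0mx !addr0 /S; congr block_mx.
      rewrite mulNmx -scalemxAl mul_mx_scalar scalerA mulVf ?gt_eqF//.
      by rewrite scale1r addNr.
    by rewrite mulNmx -scalemxAl addrC.
  have := congr1 determinant LE.
  by rewrite det_mulmx det_lblock det_ublock !det1 !mul1r det_scalar1.
Qed.

Lemma posdefmx_det_gt0 d (G : 'M[R]_d) : posdefmx G -> 0 < \det G.
Proof.
elim: d G => [|d IH] G Gpos; first by rewrite det_mx00.
have [a [b [S [a0 Spos -> _]]]] := @quad_form_schur d G Gpos.
by rewrite mulr_gt0// IH.
Qed.

Lemma quad_form_ge0 d (G : 'M[R]_d) v : posdefmx G -> 0 <= quad_form G v.
Proof.
move=> [_ Gpos]; have [->|/Gpos/ltW//] := eqVneq v 0.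
by rewrite /quad_form !mul0mx mxE.
Qed.

Lemma measurable_ellipsoid d (G : 'M[R]_d) (c : 'rV[R]_d) (s : R) :
  measurable [set x : d.-tuple (measurableTypeR R) |
                quad_form G (row_of x - c) <= s].
Proof.
have := @measurable_fun_ler _ _ _ setT _ (cst s) (measurable_quad_form G c).
move=> /(_ (measurable_cst _)) /(_ measurableT [set true]); rewrite setTI.
by apply.
Qed.

(** By induction with the Schur complement: over a point [t] of the remaining coordinates the slice
    lies in an interval of half-length [s / sqrt a], and it is empty unless [t] lies in the
    ellipsoid of [S] with the same [s]. The constant is that of a cube instead of a ball, which only
    affects [C(d)]. *)
Lemma ellipsoid_volume_le d (G : 'M[R]_d) (c : 'rV[R]_d) (s : R) :
  posdefmx G -> 0 <= s ->
  (lebesgue_measureX R d [set x | (quad_form G (row_of x - c) <= s ^+ 2)%R]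
   <= ((2 * s) ^+ d / Num.sqrt (\det G))%:E)%E.
Proof.
move=> + s0; elim: d G c => [|d IH] G c Gpos.
  rewrite det_mx00 sqrtr1 expr0 divr1 /lebesgue_measureX /= diracE.
  by rewrite lee_fin lern1 leq_b1.
have mE := measurable_ellipsoid G c (s ^+ 2).
have [a [b [S [a0 Spos detG quadE]]]] := @quad_form_schur d G Gpos.
pose c0 := lsubmx (c : 'rV_(1 + d)) ord0 ord0; pose c' := rsubmx (c : 'rV_(1 + d)).
pose E' := [set t : d.-tuple (measurableTypeR R) |
   quad_form S (row_of t - c') <= s ^+ 2].
have mE' : measurable E' by exact: measurable_ellipsoid.
(* The centre of the slice over [t]. *)
pose k (t : d.-tuple (measurableTypeR R)) :=
  c0 - ((row_of t - c') *m b) ord0 ord0.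
pose w := s / Num.sqrt a.
have sa0 : 0 < Num.sqrt a by rewrite sqrtr_gt0.
have w0 : 0 <= w by rewrite divr_ge0// ltW.
rewrite -[X in lebesgue_measureX R d.+1 X]setIT -integral_indic//.
rewrite ge0_integral_power_measureS_swap//; last first.
  by apply/measurable_EFinP; exact: measurable_indic.
apply: (@le_trans _ _ (\int[power_measure lebesgue_measure d]_t
    ((2 * w)%:E * (\1_E' t)%:E)))%E.
  apply: ge0_le_integral => //.
  - by move=> t _; apply: integral_ge0 => x _; rewrite lee_fin.
  - apply: (@measurable_fun_fubini_tonelli_G _ _ _ _ _ _
      ((EFin \o \1_[set x | quad_form G (row_of x - c) <= s ^+ 2])
         \o @cons_pair _ (measurableTypeR R) d)).
    + apply: measurableT_comp; last exact: measurable_cons_pair.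
      by apply/measurable_EFinP; exact: measurable_indic.
    + by move=> z; rewrite lee_fin.
  - apply: emeasurable_funM => //; apply/measurable_EFinP.
    exact: measurable_indic.
  move=> t _.
  have -> : (2 * w)%:E = @lebesgue_measure R `[k t - w, k t + w]%classic.
    rewrite lebesgue_measure_itv/= lte_fin; case: ltP => [_|].
      by congr EFin; lra.
    by move=> kw; congr EFin; lra.
  rewrite -[X in lebesgue_measure X]setIT -integral_indic// muleC.
  rewrite -ge0_integralZl//; last first.
    by apply/measurable_EFinP; exact: measurable_indic.
  apply: ge0_le_integral => //.
  - apply/measurable_EFinP.
    have mt : measurable_fun setT (fun x : measurableTypeR R => cons_pair (x, t)).
      apply: measurableT_comp; first exact: measurable_cons_pair.
      exact: pair2_measurable.
    exact: (measurableT_comp (measurable_indic mE) mt).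
  - by apply: measurable_funeM; apply/measurable_EFinP; exact: measurable_indic.
  move=> x _; rewrite -EFinM lee_fin.
  have [xtE|xtE] := pselect (([set x | quad_form G (row_of x - c) <= s ^+ 2])
     (cons_pair (x, t))); last by rewrite indicE memNset// mulr_ge0.
  rewrite indicE mem_set//; move: xtE => /=.
  rewrite row_of_cons/= quadE.
  have -> : lsubmx (row_mx x%:M (row_of t) - c) ord0 ord0 = x - c0.
    by rewrite /c0 mxE [LHS]mxE row_mxEl !mxE eqxx mulr1n.
  have -> : rsubmx (row_mx x%:M (row_of t) - c) = row_of t - c'.
    by apply/rowP => j; rewrite mxE [LHS]mxE row_mxEr !mxE.
  have qS0 := quad_form_ge0 (row_of t - c') Spos.
  have -> : x - c0 + ((row_of t - c') *m b) ord0 ord0 = x - k t by rewrite /k; ring.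
  move=> xs.
  have ax0 : 0 <= a * (x - k t) ^+ 2 by rewrite mulr_ge0 ?sqr_ge0// ltW.
  rewrite indicE mem_set; last by rewrite /E'/=; lra.
  rewrite indicE mem_set ?mulr1//= in_itv/= -ler_distl.
  rewrite /w ler_pdivlMr// -(ler_pXn2r (_ : 0 < 2)%N)//; last first.
    by rewrite nnegrE mulr_ge0// ltW.
  by rewrite exprMn real_normK ?num_real// sqr_sqrtr ?(ltW a0)//; lra.
rewrite ge0_integralZl//; last 2 first.
- by apply/measurable_EFinP; exact: measurable_indic.
- by rewrite lee_fin mulr_ge0.
rewrite integral_indic// setIT.
apply: (@le_trans _ _ ((2 * w)%:E * ((2 * s) ^+ d / Num.sqrt (\det S))%:E)%E).
  by rewrite lee_wpmul2l// ?lee_fin ?mulr_ge0//; exact: IH.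
rewrite -EFinM lee_fin detG sqrtrM ?(ltW a0)// invfM exprS /w.
by rewrite le_eqVlt; apply/orP; left; apply/eqP; ring.
Qed.

Lemma box_bigcap d (w : 'rV[R]_d) (e : R) :
  [set x : d.-tuple (measurableTypeR R) | forall i, `|tnth x i - w ord0 i| <= e] =
  \bigcap_(i in [set: 'I_d])
    ((fun x => tnth x i) @^-1` `[w ord0 i - e, w ord0 i + e]%classic).
Proof.
apply/seteqP; split => x /= H i; first by move=> _ /=; rewrite in_itv/= -ler_distl H.
by have := H i I; rewrite /= in_itv/= -ler_distl.
Qed.

Lemma measurable_box d (w : 'rV[R]_d) (e : R) :
  measurable [set x : d.-tuple (measurableTypeR R) |
                forall i, `|tnth x i - w ord0 i| <= e].
Proof.
rewrite box_bigcap; apply: fin_bigcap_measurable; first exact: finite_finset.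
by move=> i _; rewrite -[X in measurable X]setTI; apply: (measurable_tnth i).
Qed.

Lemma box_volume d (w : 'rV[R]_d) (e : R) : 0 < e ->
  (lebesgue_measureX R d [set x | forall i, (`|tnth x i - w ord0 i| <= e)%R]
   = ((2 * e) ^+ d)%:E)%E.
Proof.
move=> e0.
pose f (i : 'I_d) : measurableTypeR R -> R := \1_(`[w ord0 i - e, w ord0 i + e]%classic).
have mA := measurable_box w e; set A := [set x | _] in mA *.
rewrite -[X in lebesgue_measureX R d X]setIT -integral_indic//.
under eq_integral => x _.
  rewrite (_ : \1_A x = \prod_(i < d) f i (tnth x i)).
    over.
  have [xA|xA] := pselect (A x).
    rewrite indicE mem_set// big1// => i _; rewrite /f indicE mem_set//=.
    by rewrite in_itv/= -ler_distl.
  rewrite indicE memNset//; have /existsNP[i xi] := xA.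
  rewrite (bigD1 i)//= {1}/f indicE memNset ?mul0r//=.
  by rewrite in_itv/= -ler_distl.
rewrite (@integral_prod_power_measure _ _ _ _ _ _ (fun=> 2 * e))//.
- by rewrite prodr_const card_ord.
- by move=> i; exact: measurable_indic.
- move=> i; rewrite integral_indic// setIT.
  transitivity (@lebesgue_measure R `[w ord0 i - e, w ord0 i + e]%classic) => //.
  rewrite lebesgue_measure_itv/= lte_fin ifT; last lra.
  by congr EFin; lra.
Qed.

End lebesgue_volume.

(** * Le Cam's two-point bound *)

Section two_points.
Context (R : realType).

(* With likelihood ratio [B / A]: [min A B >= B - B^2 / (4 A)]. *)
Lemma two_point_pointwise (A B W u v e : R) :
  0 <= A -> 0 <= B -> 0 <= W -> 0 <= u -> 0 <= v -> 0 <= e -> e <= u + v ->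
  W * A = B ^+ 2 -> (A = 0 -> B = 0) ->
  e * B <= (A * u + B * v) + e / 4 * W.
Proof.
move=> A0 B0 W0 u0 v0 e0 euv WAB AB.
have [A00|A00] := eqVneq A 0.
  by rewrite (AB A00) A00 !mul0r mulr0 !add0r mulr_ge0// divr_ge0.
have Agt : 0 < A by rewrite lt_neqAle eq_sym A00.
have [BA|/ltW BA] := leP B A.
  have h1 : B * u <= A * u by rewrite ler_wpM2r.
  have h2 : B * e <= B * (u + v) by rewrite ler_wpM2l.
  have h3 : 0 <= e / 4 * W by rewrite mulr_ge0// divr_ge0.
  lra.
have h1 : A * v <= B * v by rewrite ler_wpM2r.
have h2 : A * e <= A * (u + v) by rewrite ler_wpM2l.
have h3 : B <= A + W / 4.
  rewrite -(ler_pM2r Agt).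
  have := sqr_ge0 (A - B / 2); rewrite sqrrB; nra.
have h4 : e * B <= e * (A + W / 4) by rewrite ler_wpM2l.
lra.
Qed.

Context (d : nat).

Local Notation pt := (d.-tuple (measurableTypeR R)).

(** [two_point_pointwise] is integrated with [A] and [B] the likelihoods under [p] and [q], and [W]
    the product of the [q^2 / p], whose integral is [c^n]. As [c^n <= 2], the correction costs at
    most half of the separation, and twice the larger risk bounds the other half. Where [p] vanishes
    the quotient is [0] by convention; the implication [p x = 0 -> q x = 0] ensures that no mass of
    [q] is lost there. *)
Lemma minimax_risk_two_point n (T : ('rV[R]_d -> R) -> R) (p q : 'rV[R]_d -> R)
    (c : R) :
  density p -> density q -> (forall x, p x = 0 -> q x = 0) ->
  (\int[lebesgue_measureX R d]_x (q (row_of x) ^+ 2 / p (row_of x))%:E = c%:E)%E ->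
  c ^+ n <= 2 ->
  ((`|T p - T q| / 4)%:E <= minimax_risk n T [set p; q])%E.
Proof.
move=> [mp p0 p1] [mq q0 q1] pq0 intw cn.
pose e : R := `|T p - T q|; rewrite -[`|_|]/e.
have e0 : 0 <= e by exact: normr_ge0.
apply: le_ereal_inf_tmp => _ /= [t mt <-].
set S := ereal_sup _.
pose E1 := iid_expectation p (fun x => `|t x - T p|).
pose E2 := iid_expectation q (fun x => `|t x - T q|).
have E1S : (E1 <= S)%E by apply: ereal_sup_ubound; exists p => //; left.
have E2S : (E2 <= S)%E by apply: ereal_sup_ubound; exists q => //; right.
pose P (f : 'rV[R]_d -> R) (x : n.-tuple pt) := \prod_(i < n) f (row_of (tnth x i)).
pose w (x : 'rV[R]_d) := q x ^+ 2 / p x.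
have mw : measurable_fun setT (w \o @row_of R d : pt -> R).
  apply: measurable_funM; first exact: measurable_funX.
  exact: (measurable_fun_invr_ge0 mp (fun=> p0 _)).
have w0 x : 0 <= w x by rewrite divr_ge0// sqr_ge0.
have mP f : measurable_fun setT ((f \o @row_of R d) : pt -> R) -> measurable_fun setT (P f).
  move=> mf; apply: measurable_prod => i _.
  exact: (measurableT_comp mf (measurable_tnth i)).
have P0 f x : (forall z, 0 <= f z) -> 0 <= P f x by move=> f0; exact: prodr_ge0.
have mE (f : 'rV[R]_d -> R) : measurable_fun setT ((f \o @row_of R d) : pt -> R) ->
   measurable_fun setT (fun x : n.-tuple pt => P f x * `|t x - T f|).
  move=> mf; apply: measurable_funM; first exact: mP.
  by apply: measurableT_comp => //; apply: measurable_funB.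
have intP f (r : R) : measurable_fun setT ((f \o @row_of R d) : pt -> R) -> (forall z, 0 <= f z) ->
    (\int[lebesgue_measureX R d]_x (f (row_of x))%:E = r%:E)%E ->
    (\int[power_measure (lebesgue_measureX R d) n]_x (P f x)%:E = (r ^+ n)%:E)%E.
  move=> mf f0 fr.
  have := @integral_prod_power_measure _ _ _ _ n (fun=> f \o @row_of R d)
    (fun=> r) (fun=> mf) (fun _ x => f0 _) (fun=> fr).
  by rewrite prodr_const card_ord.
have mPE f : measurable_fun setT (f \o @row_of R d : pt -> R) ->
    measurable_fun setT (fun x : n.-tuple pt => (P f x)%:E).
  by move=> mf; apply/measurable_EFinP; exact: mP.
have mEE (f : 'rV[R]_d -> R) : measurable_fun setT (f \o @row_of R d : pt -> R) ->
   measurable_fun setT (fun x : n.-tuple pt => (P f x * `|t x - T f|)%:E).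
  by move=> mf; apply/measurable_EFinP; exact: mE.
have P0E f x : (forall z, 0 <= f z) -> (0 <= (P f x)%:E)%E.
  by move=> f0; rewrite lee_fin P0.
have E0E (f : 'rV[R]_d -> R) (x : n.-tuple pt) : (forall z, 0 <= f z) ->
   (0 <= (P f x * `|t x - T f|)%:E)%E.
  by move=> f0; rewrite lee_fin mulr_ge0// P0.
have e40 : (0 <= (e / 4)%:E)%E by rewrite lee_fin divr_ge0.
have main : (e%:E <= (E1 + E2) + (e / 4 * 2)%:E)%E.
  rewrite -[e in X in (X <= _)%E]mulr1 -[X in e * X](expr1n _ n) EFinM.
  rewrite -(intP q)// -ge0_integralZl//; [|exact: mPE|by move=> x _; exact: P0E].
  apply: (@le_trans _ _ (E1 + E2 + (e / 4)%:E *
    \int[power_measure (lebesgue_measureX R d) n]_x (P w x)%:E)%E); last first.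
    rewrite leeD2l// (intP w c)//.
    by rewrite -EFinM lee_fin ler_wpM2l// divr_ge0.
  rewrite -ge0_integralZl//; [|exact: mPE|by move=> x _; exact: P0E].
  rewrite /E1 /E2 /iid_expectation -ge0_integralD//; [|by move=> x _; exact: E0E
     |exact: mEE|by move=> x _; exact: E0E|exact: mEE].
  rewrite -ge0_integralD//; [|by move=> x _; rewrite adde_ge0//; exact: E0E
     |by apply: emeasurable_funD; exact: mEE|by move=> x _; rewrite mule_ge0//; exact: P0E
     |by apply: measurable_funeM; exact: mPE].
  apply: ge0_le_integral => //.
  - by move=> x _; rewrite -EFinM lee_fin mulr_ge0 ?P0.
  - by apply: measurable_funeM; exact: mPE.
  - apply: emeasurable_funD; first by apply: emeasurable_funD; exact: mEE.
    by apply: measurable_funeM; exact: mPE.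
  move=> x _; rewrite -!EFinM -!EFinD lee_fin.
  apply: two_point_pointwise; rewrite ?P0//.
  - by rewrite /e (distrC (t x)); exact: ler_distD.
  - rewrite /P -prodrXl -big_split/=; apply: eq_bigr => i _; rewrite /w.
    have [pi0|pi0] := eqVneq (p (row_of (tnth x i))) 0.
      by rewrite (pq0 _ pi0) pi0 expr0n mulr0.
    by rewrite divfK.
  - move=> /eqP /prodf_eq0 [i _ /eqP pi0].
    by rewrite /P (bigD1 i)//= (pq0 _ pi0) mul0r.
have E12 : (E1 + E2 <= S + S)%E by exact: leeD.
have {}main := le_trans main (leeD2r (e / 4 * 2)%:E E12).
move: (S) main => [s| |]; rewrite ?leey//.
by rewrite -!EFinD !lee_fin; lra.
Qed.

End two_points.

(** * Convex perturbations *)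

Lemma continuous_sum (R : numFieldType) (T : topologicalType) (I : Type)
    (r : seq I) (f : I -> T -> R) :
  (forall i, continuous (f i)) -> continuous (fun x => \sum_(i <- r) f i x).
Proof.
move=> cf x; elim: r => [|i r IH].
  by under eq_fun do rewrite big_nil; exact: cvg_cst.
under eq_fun do rewrite big_cons.
by apply: cvgD => //; exact: cf.
Qed.

(** * The norm of a positive definite matrix *)

Section quad_norm.
Context (R : realType) (d : nat) (G : 'M[R]_d).
Hypothesis Gpos : posdefmx G.
Implicit Types u v w : 'rV[R]_d.

Definition bil_form u v : R := (u *m G *m v^T) ord0 ord0.

Lemma bil_formC u v : bil_form u v = bil_form v u.
Proof.
have [Gsym _] := Gpos.
rewrite /bil_form; have -> : u *m G *m v^T = (v *m G *m u^T)^T.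
  by rewrite !trmx_mul trmxK Gsym mulmxA.
by rewrite mxE.
Qed.

Lemma quad_formD (a b : R) u v : quad_form G (a *: u + b *: v) =
  a ^+ 2 * quad_form G u + 2 * (a * b) * bil_form u v + b ^+ 2 * quad_form G v.
Proof.
have vu : bil_form v u = bil_form u v by rewrite bil_formC.
rewrite /bil_form in vu *; rewrite /quad_form.
rewrite linearD/= !linearZ/= !mulmxDl !mulmxDr -!scalemxAl -!scalemxAr.
rewrite !scalerA [LHS]mxE [X in X + _]mxE [X in _ + X = _]mxE.
have sE (c : R) (M : 'M[R]_1) : (c *: M) ord0 ord0 = c * M ord0 ord0 by rewrite mxE.
by rewrite !sE vu; ring.
Qed.

(** Cauchy-Schwarz: the vector tested below is [quad_form G v] times the component of [u] orthogonal
    to [v]. *)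
Lemma bil_form_sqr_le u v : bil_form u v ^+ 2 <= quad_form G u * quad_form G v.
Proof.
have [v0|v0] := eqVneq v 0.
  by rewrite v0 /bil_form trmx0 mulmx0 mxE expr0n mulr_ge0// quad_form_ge0.
have qv : 0 < quad_form G v by apply: Gpos.2.
have := quad_form_ge0 (quad_form G v *: u + (- bil_form u v) *: v) Gpos.
rewrite quad_formD; set b := bil_form u v; set V := quad_form G v in qv *.
have -> : V ^+ 2 * quad_form G u + 2 * (V * - b) * b + (- b) ^+ 2 * V =
   V * (quad_form G u * V - b ^+ 2) by ring.
by rewrite pmulr_rge0// subr_ge0.
Qed.

Definition quad_norm v : R := Num.sqrt (quad_form G v).

Lemma quad_norm_ge0 v : 0 <= quad_norm v. Proof. exact: sqrtr_ge0. Qed.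

Lemma quad_norm_sqr v : quad_norm v ^+ 2 = quad_form G v.
Proof. by rewrite sqr_sqrtr// quad_form_ge0. Qed.

Lemma quad_norm_leE v (s : R) : 0 <= s -> (quad_norm v <= s) = (quad_form G v <= s ^+ 2).
Proof.
by move=> s0; rewrite -quad_norm_sqr ler_sqr ?nnegrE ?quad_norm_ge0.
Qed.

Lemma bil_form_le u v : `|bil_form u v| <= quad_norm u * quad_norm v.
Proof.
rewrite -(ler_pXn2r (_ : 0 < 2)%N) ?nnegrE ?mulr_ge0 ?quad_norm_ge0//.
by rewrite exprMn !quad_norm_sqr real_normK ?num_real// bil_form_sqr_le.
Qed.

Lemma quad_normZD (a b : R) u v :
  quad_norm (a *: u + b *: v) <= `|a| * quad_norm u + `|b| * quad_norm v.
Proof.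
rewrite -(ler_pXn2r (_ : 0 < 2)%N) ?nnegrE ?addr_ge0 ?mulr_ge0 ?quad_norm_ge0//.
rewrite quad_norm_sqr quad_formD sqrrD !exprMn !quad_norm_sqr.
rewrite !real_normK ?num_real//.
have : (a * b) * bil_form u v <= (`|a| * `|b|) * (quad_norm u * quad_norm v).
  rewrite (le_trans (ler_norm _))// !normrM ler_wpM2l ?mulr_ge0//.
  exact: bil_form_le.
lra.
Qed.

Lemma quad_normZ (a : R) u : quad_norm (a *: u) = `|a| * quad_norm u.
Proof.
rewrite /quad_norm -[a *: u]addr0 -(scale0r u) quad_formD.
rewrite mulr0 mulr0 !mul0r expr0n mul0r !addr0 sqrtrM ?sqr_ge0//.
by rewrite sqrtr_sqr.
Qed.

Lemma quad_norm0 : quad_norm 0 = 0.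
Proof. by rewrite -(scale0r 0) quad_normZ normr0 mul0r. Qed.

Lemma quad_normD u v : quad_norm (u + v) <= quad_norm u + quad_norm v.
Proof. by have := quad_normZD 1 1 u v; rewrite !scale1r normr1 !mul1r. Qed.

Lemma quad_norm_conv (t : R) x0 x y : 0 <= t <= 1 ->
  quad_norm (t *: x + (1 - t) *: y - x0) <=
  t * quad_norm (x - x0) + (1 - t) * quad_norm (y - x0).
Proof.
move=> /andP[t0 t1].
have -> : t *: x + (1 - t) *: y - x0 = t *: (x - x0) + (1 - t) *: (y - x0).
  by apply/rowP => i; rewrite !mxE; ring.
by apply: (le_trans (quad_normZD _ _ _ _)); rewrite !ger0_norm// subr_ge0.
Qed.

Lemma posdefmx_unit : G \in unitmx.
Proof. by rewrite unitmxE unitfE gt_eqF// posdefmx_det_gt0. Qed.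

(** Each coordinate is the pairing with a fixed vector [w i], so Cauchy-Schwarz bounds it. This fits
    ellipsoids into the coordinate boxes that describe neighbourhoods. *)
Lemma coord_le_quad_norm : exists2 K : R, 0 < K &
  forall v i, `|v ord0 i| <= K * quad_norm v.
Proof.
pose w (i : 'I_d) : 'rV[R]_d := delta_mx ord0 i *m invmx G.
exists (1 + \sum_i quad_norm (w i)).
  by rewrite ltr_wpDr// sumr_ge0// => i _; exact: quad_norm_ge0.
move=> v i.
have -> : v ord0 i = bil_form (w i) v.
  rewrite /bil_form /w mulmxKV ?posdefmx_unit// -rowE.
  by rewrite !mxE.
rewrite (le_trans (bil_form_le _ _))// ler_wpM2r ?quad_norm_ge0//.
rewrite (bigD1 i)//= addrCA lerDl addr_ge0// sumr_ge0// => j _.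
exact: quad_norm_ge0.
Qed.

Lemma continuous_quad_norm (x0 : 'rV[R]_d) :
  continuous (fun x : 'rV[R]_d => quad_norm (x - x0)).
Proof.
have cB i : continuous (fun x : 'rV[R]_d => x ord0 i - x0 ord0 i).
  move=> x; have hx : {for x, continuous (fun M : 'rV[R]_d => M ord0 i)}.
    exact: coord_continuous.
  have hc : {for x, continuous (cst (x0 ord0 i) : 'rV[R]_d -> R)} by exact: cst_continuous.
  exact: (continuousB hx hc).
have cQ : continuous (fun x : 'rV[R]_d => quad_form G (x - x0)).
  have -> : (fun x : 'rV[R]_d => quad_form G (x - x0)) =
    (fun x => \sum_(j < d) (\sum_(i < d) (x ord0 i - x0 ord0 i) * G i j)
       * (x ord0 j - x0 ord0 j)).
    apply/funext => x; rewrite /quad_form mxE; apply: eq_bigr => j _.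
    by rewrite !mxE; congr (_ * _); apply: eq_bigr => i _; rewrite !mxE.
  apply: continuous_sum => j.
  have cS : continuous (fun x : 'rV[R]_d => \sum_(i < d) (x ord0 i - x0 ord0 i) * G i j).
    apply: continuous_sum => i x.
    have hc : {for x, continuous (cst (G i j) : 'rV[R]_d -> R)} by exact: cst_continuous.
    exact: (continuousM (cB i x) hc).
  by move=> x; exact: (continuousM (cS x) (cB j x)).
move=> x; apply: (@continuous_comp _ _ _ (fun x : 'rV[R]_d => quad_form G (x - x0)) Num.sqrt).
  exact: cQ.
exact: sqrt_continuous.
Qed.

End quad_norm.

Section convex_functions.
Context (R : realType) (d : nat).
Implicit Types (f g q : 'rV[R]_d -> \bar R) (x y : 'rV[R]_d).

(** Real upper bounds in place of the values of [f] avoid arithmetic with infinities. *)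
Lemma econvexP f : econvex f <->
  (forall x y (a b t : R), (f x <= a%:E)%E -> (f y <= b%:E)%E -> 0 <= t <= 1 ->
     (f (t *: x + (1 - t) *: y)%R <= (t * a + (1 - t) * b)%:E)%E).
Proof.
split=> [cf x y a b t fxa fyb /andP[t0 t1]|cf [x a] [y b] t].
  have := cf (x, a : R^o) (y, b : R^o) (Itv01 t0 t1).
  by rewrite !inE /epigraph/= => /(_ fxa fyb).
rewrite !inE /epigraph/= => fxa fyb.
by apply: cf => //; apply/andP; split.
Qed.

(* A violation of the maximum principle at one index propagates to the right. *)
Lemma discrete_max_principle (D : nat -> R) m : D 0%N <= 0 -> D m <= 0 ->
  (forall i, (0 < i < m)%N -> exists l : R,
     0 < l < 1 /\ D i <= l * D i.-1 + (1 - l) * D i.+1) ->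
  forall i, (i <= m)%N -> D i <= 0.
Proof.
move=> D0 Dm loc i im; rewrite leNgt; apply/negP => Di.
have exP : exists i, 0 < D i by exists i.
pose i0 := ex_minn exP.
have [Di0 mini0] : 0 < D i0 /\ forall j, 0 < D j -> (i0 <= j)%N.
  by rewrite /i0; case: ex_minnP.
have i0m : (i0 < m)%N.
  rewrite ltn_neqAle (leq_trans (mini0 _ Di) im) andbT.
  by apply/eqP => i0m; move: Di0; rewrite i0m ltNge Dm.
have i00 : (0 < i0)%N.
  by rewrite lt0n; apply/eqP => i00; move: Di0; rewrite i00 ltNge D0.
(* From the first positive index on, an averaged value above its left neighbour is below its right
   one, so [D] increases strictly up to [m], against [D m <= 0]. *)
have step k : (i0 + k < m)%N -> 0 < D (i0 + k)%N /\ D (i0 + k)%N < D (i0 + k).+1.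
  elim: k => [|k IH]; rewrite ?addn0 ?addnS => km.
    split => //.
    have Dp : D i0.-1 <= 0.
      rewrite leNgt; apply/negP => /mini0.
      by rewrite leqNgt prednK// leqnn.
    have [|l [/andP[l0 l1] Dl]] := loc i0; first by rewrite i00.
    have lDp : l * D i0.-1 <= 0 by rewrite mulr_ge0_le0// ltW.
    have h : D i0 <= (1 - l) * D i0.+1 by lra.
    rewrite -(@ltr_pM2l _ (1 - l)) ?subr_gt0//.
    by have := mulr_gt0 l0 Di0; lra.
  have [Dk Dkk] := IH (ltnW km).
  split; first exact: lt_trans Dkk.
  have [|l [/andP[l0 l1] Dl]] := loc (i0 + k).+1; first by rewrite ltn0Sn.
  rewrite /= in Dl.
  have h : l * D (i0 + k)%N < l * D (i0 + k).+1 by rewrite ltr_pM2l.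
  rewrite -(@ltr_pM2l _ (1 - l)) ?subr_gt0//; lra.
case: m Dm loc im i0m step => // m Dm _ _ i0m step.
rewrite ltnS in i0m.
have [|Dm1 Dm2] := step (m - i0)%N; first by rewrite subnKC.
rewrite subnKC// in Dm1 Dm2.
by have := lt_trans Dm1 Dm2; rewrite ltNge Dm.
Qed.

End convex_functions.

(** * The radial profile of the perturbation *)

Section radial_bump.
Context (R : realType).
Implicit Types r e del s t : R.

(* [s^2/2 + bump r e del s] is the maximum of the convex functions [s^2/2 - del],
   [r s - r^2/2 + ((s - r)_+)^2/2] and [e]: it is [e] at [0] and [s^2/2] for
   [s >= r]. *)
Definition bump r e del s : R :=
  Num.max (Num.max (- del) (- (2^-1 * (Num.max (r - s) 0) ^+ 2))) (e - 2^-1 * s ^+ 2).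

Lemma bump_ge r e del s : - del <= bump r e del s.
Proof. by rewrite /bump !le_max lexx. Qed.

Lemma bump_le r e del s : 0 <= e -> 0 <= del -> bump r e del s <= e.
Proof.
move=> e0 del0; have := sqr_ge0 s; have := sqr_ge0 (Num.max (r - s) 0).
by rewrite /bump !ge_max => ? ?; apply/andP; split; [apply/andP; split|]; lra.
Qed.

Lemma bump_le0 r e del s : 0 <= del -> 2 * e <= s ^+ 2 -> bump r e del s <= 0.
Proof.
move=> del0 es; have := sqr_ge0 (Num.max (r - s) 0).
by rewrite /bump !ge_max => ?; apply/andP; split; [apply/andP; split|]; lra.
Qed.

Lemma bump_eq0 r e del s : 0 <= del -> 0 <= r -> 2 * e <= r ^+ 2 -> r <= s ->
  bump r e del s = 0.
Proof.
move=> del0 r0 er rs; apply/eqP; rewrite eq_le; apply/andP; split.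
  by apply: bump_le0 => //; rewrite (le_trans er)// ler_sqr ?nnegrE// (le_trans r0).
rewrite /bump !le_max; apply/orP; left; apply/orP; right.
by rewrite [Num.max _ _]max_r ?subr_le0// expr0n mulr0 oppr0.
Qed.

Lemma bump0 r e del : 0 <= e -> 0 <= del -> bump r e del 0 = e.
Proof.
move=> e0 del0; apply/eqP; rewrite eq_le bump_le//=.
by rewrite /bump le_max; apply/orP; right; rewrite expr0n/= mulr0 subr0.
Qed.

Lemma bump_eqN r e del s : s <= r -> 2 * (e + del) <= s ^+ 2 ->
  2 * del <= (r - s) ^+ 2 -> bump r e del s = - del.
Proof.
move=> sr es ds; apply/eqP; rewrite eq_le bump_ge andbT.
rewrite /bump !ge_max lexx/= [Num.max _ _]max_l ?subr_ge0//.
by apply/andP; split; lra.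
Qed.

(** The constant 64 makes [s^2 >= r^2 / 16 >= 4 e], which covers [2 (e + del)], while
    [(r - s)^2 >= r^2 / 4] covers [2 del]. The annulus thus also misses the ellipsoid on which [g]
    may be raised. *)
Lemma bump_annulus r e del s : 0 < r -> 0 <= del -> del <= e -> 64 * e <= r ^+ 2 ->
  r / 4 <= s -> s <= r / 2 -> bump r e del s = - del /\ 2 * e < s ^+ 2.
Proof.
move=> r0 del0 dele er rs sr.
have r20 : 0 < r ^+ 2 by rewrite exprn_gt0.
have s2 : r ^+ 2 / 16 <= s ^+ 2.
  rewrite (_ : _ / 16 = (r / 4) ^+ 2); last by field.
  by rewrite ler_sqr ?nnegrE//; lra.
have rs2 : r ^+ 2 / 4 <= (r - s) ^+ 2.
  rewrite (_ : _ / 4 = (r / 2) ^+ 2); last by field.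
  by rewrite ler_sqr ?nnegrE//; lra.
by split; [apply: bump_eqN|]; lra.
Qed.

Lemma bump_anti r e del del' s : del <= del' -> bump r e del' s <= bump r e del s.
Proof.
move=> dd; rewrite {1}/bump !ge_max; apply/andP; split; last first.
  by rewrite /bump le_max lexx orbT.
by apply/andP; split; rewrite /bump !le_max ?lexx ?orbT//; apply/orP; left;
  apply/orP; left; rewrite lerN2.
Qed.

(** Together with [bump_anti] this makes the total mass a Lipschitz function of [del]. *)
Lemma bump_lip r e del del' s : del <= del' ->
  bump r e del s <= bump r e del' s + (del' - del).
Proof.
move=> dd; rewrite {1}/bump !ge_max.
have h1 := bump_ge r e del' s.
have h2 : - (2^-1 * (Num.max (r - s) 0) ^+ 2) <= bump r e del' s.
  by rewrite /bump !le_max lexx orbT.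
have h3 : e - 2^-1 * s ^+ 2 <= bump r e del' s by rewrite /bump !le_max lexx orbT.
by apply/andP; split; [apply/andP; split|]; lra.
Qed.

(** The triangle inequality only bounds [s], the norm at the intermediate point, by the convex
    combination of the norms; each of the three pieces is therefore used as a function that is
    convex and also nondecreasing. *)
Lemma bump_convex r e del s s1 s2 t : 0 <= r -> 0 <= s -> 0 <= s1 -> 0 <= s2 ->
  0 <= t <= 1 -> s <= t * s1 + (1 - t) * s2 ->
  2^-1 * s ^+ 2 + bump r e del s <=
  t * (2^-1 * s1 ^+ 2 + bump r e del s1)
  + (1 - t) * (2^-1 * s2 ^+ 2 + bump r e del s2).
Proof.
move=> r0 s0 s10 s20 /andP[t0 t1] ss.
have t10 : 0 <= 1 - t by lra.
have sqc (a b c : R) : 0 <= a -> a <= t * b + (1 - t) * c ->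
    a ^+ 2 <= t * b ^+ 2 + (1 - t) * c ^+ 2.
  move=> a0 abc.
  have h : a ^+ 2 <= (t * b + (1 - t) * c) ^+ 2.
    by rewrite ler_sqr ?nnegrE// (le_trans a0).
  apply: (le_trans h).
  have := mulr_ge0 (mulr_ge0 t0 t10) (sqr_ge0 (b - c)).
  by move=> ?; rewrite -subr_ge0; apply: le_trans (_ : t * (1 - t) * (b - c) ^+ 2 <= _) => //; lra.
pose B1 := bump r e del s1; pose B2 := bump r e del s2.
have wt (x1 x2 : R) : x1 <= 2^-1 * s1 ^+ 2 + B1 -> x2 <= 2^-1 * s2 ^+ 2 + B2 ->
   t * x1 + (1 - t) * x2 <= t * (2^-1 * s1 ^+ 2 + B1) + (1 - t) * (2^-1 * s2 ^+ 2 + B2).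
  by move=> ? ?; rewrite lerD// ler_wpM2l.
have subB (x y : R) : (2^-1 * x ^+ 2 + bump r e del x <= y) =
   (bump r e del x <= y - 2^-1 * x ^+ 2) by rewrite lerBrDl.
rewrite subB {1}/bump !ge_max; apply/andP; split; [apply/andP; split|].
- rewrite lerBrDl; apply: le_trans (wt (2^-1 * s1 ^+ 2 - del) (2^-1 * s2 ^+ 2 - del) _ _);
    [|by rewrite lerD2l bump_ge..].
  by have := sqc s s1 s2 s0 ss; lra.
- rewrite lerBrDl.
  (* The middle piece is the tangent line of [x^2 / 2] at [r] for [x <= r], and [x^2 / 2] itself
     beyond: a sum of a linear function and the square of a positive part. *)
  have thE (x : R) : 2^-1 * x ^+ 2 - 2^-1 * (Num.max (r - x) 0) ^+ 2 =
      r * x - 2^-1 * r ^+ 2 + 2^-1 * (Num.max (x - r) 0) ^+ 2.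
    case: (leP r x) => rx.
      by rewrite [Num.max (r - x) _]max_r ?subr_le0// [Num.max (x - r) _]max_l ?subr_ge0//; lra.
    by rewrite [Num.max (r - x) _]max_l ?subr_ge0 ?ltW// [Num.max (x - r) _]max_r ?subr_le0 ?ltW//; lra.
  apply: le_trans (wt (2^-1 * s1 ^+ 2 - 2^-1 * (Num.max (r - s1) 0) ^+ 2)
     (2^-1 * s2 ^+ 2 - 2^-1 * (Num.max (r - s2) 0) ^+ 2) _ _);
    [|by rewrite lerD2l /bump !le_max lexx orbT..].
  rewrite !thE.
  have m0 (x : R) : 0 <= Num.max (x - r) 0 by rewrite le_max lexx orbT.
  have ml (x : R) : x - r <= Num.max (x - r) 0 by rewrite le_max lexx.
  have mx : Num.max (s - r) 0 <= t * Num.max (s1 - r) 0 + (1 - t) * Num.max (s2 - r) 0.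
    rewrite ge_max; apply/andP; split; last by rewrite addr_ge0// mulr_ge0.
    have h1 : t * (s1 - r) <= t * Num.max (s1 - r) 0 by rewrite ler_wpM2l.
    have h2 : (1 - t) * (s2 - r) <= (1 - t) * Num.max (s2 - r) 0 by rewrite ler_wpM2l.
    lra.
  have := sqc _ _ _ (m0 s) mx.
  have : r * s <= r * (t * s1 + (1 - t) * s2) by rewrite ler_wpM2l.
  lra.
- rewrite lerBrDl; apply: le_trans (wt e e _ _);
    [|by rewrite -lerBlDl /bump le_max lexx orbT..].
  lra.
Qed.

End radial_bump.

Lemma outer_points (R : realFieldType) (r r1 nu nv nw duv duw dvw : R) :
  duv < r1 - r -> duw <= duv -> dvw <= duv -> nu <= nv + duv -> nv <= nu + duv ->
  nu <= nw + duw -> nv <= nw + dvw -> r1 <= nu \/ r1 <= nv ->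
  [/\ r <= nu, r <= nv & r <= nw].
Proof. by move=> ? ? ? ? ? ? ? [?|?]; split; lra. Qed.

(** * From local to global convexity *)

Section local_perturbation.
Context (R : realType) (d : nat) (G : 'M[R]_d) (x0 : 'rV[R]_d).
Hypothesis Gpos : posdefmx G.
Local Notation N x := (quad_norm G (x - x0)).

Definition convex_on_ellipsoid (f : 'rV[R]_d -> \bar R) (r : R) :=
  forall x y (a b t : R), N x < r -> N y < r ->
    (f x <= a%:E)%E -> (f y <= b%:E)%E -> 0 <= t <= 1 ->
    (f (t *: x + (1 - t) *: y)%R <= (t * a + (1 - t) * b)%:E)%E.

(** The chord inequality is wanted at [t], so [t] has to be a node: [[0, t]] and [[t, 1]] are each
    cut into [K] equal pieces. *)
Lemma exists_mesh (t : R) (K : nat) : 0 < t < 1 -> (0 < K)%N ->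
  exists s : nat -> R,
    [/\ s 0%N = 0, s K = t, s (K + K)%N = 1,
        forall i, (i <= K + K)%N -> 0 <= s i <= 1 &
        forall i, exists al be : R, [/\ 0 < al <= K%:R^-1, 0 < be <= K%:R^-1,
          s i.+1 = s i + al & s i.+2 = s i.+1 + be]].
Proof.
move=> /andP[t0 t1] K0.
have K0r : 0 < K%:R :> R by rewrite ltr0n.
(* [minn] saturates at [K] and the truncated subtraction is [0] up to [K], so one formula describes
   both halves. *)
pose s i : R := t / K%:R * (minn i K)%:R + (1 - t) / K%:R * (i - K)%:R.
pose c i : R := if (i < K)%N then t / K%:R else (1 - t) / K%:R.
have sS i : s i.+1 = s i + c i.
  rewrite /s /c; case: ltnP => iK.
    have -> : (i.+1 - K)%N = 0%N by apply/eqP; rewrite subn_eq0.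
    have -> : (i - K)%N = 0%N by apply/eqP; rewrite subn_eq0 ltnW.
    by rewrite (minn_idPl iK) -natr1; ring.
  by rewrite (minn_idPr (leqW iK)) subSn// -natr1; ring.
have cb i : 0 < c i <= K%:R^-1.
  rewrite /c; case: ifP => _; rewrite divr_gt0 ?subr_gt0//= ler_piMl ?invr_ge0 ?(ltW K0r)//; lra.
have sK : s K = t by rewrite /s minnn subnn mulr0 addr0 divfK// gt_eqF.
exists s; split => //.
- by rewrite /s min0n sub0n !mulr0 addr0.
- by rewrite /s addnK (minn_idPr (leq_addr _ _)) !divfK ?gt_eqF//; ring.
- move=> i iK; apply/andP; split.
    rewrite /s addr_ge0// mulr_ge0// divr_ge0//; lra.
  have h1 : t / K%:R * (minn i K)%:R <= t.
    rewrite mulrAC -mulrA ler_piMr ?(ltW t0)// ler_pdivrMr// mul1r ler_nat geq_minr//.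
  have h2 : (1 - t) / K%:R * (i - K)%:R <= 1 - t.
    rewrite mulrAC -mulrA ler_piMr ?subr_ge0 ?(ltW t1)// ler_pdivrMr// mul1r ler_nat.
    by rewrite leq_subLR.
  by rewrite /s; lra.
- by move=> i; exists (c i), (c i.+1); split.
Qed.

(* Along a segment cut by a fine mesh, three consecutive points lie either in the
   ellipsoid of radius [r1] or outside that of radius [r]; the deviation of [f]
   from its chord then satisfies the discrete maximum principle. *)
Lemma econvex_glue (g f : 'rV[R]_d -> \bar R) (phi : 'rV[R]_d -> R) (r r1 : R) :
  r < r1 -> econvex g -> (forall x, g x != -oo%E) ->
  (forall x, f x = (g x + (phi x)%:E)%E) -> (forall x, r <= N x -> phi x = 0) ->
  convex_on_ellipsoid f r1 -> econvex f.
Proof.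
move=> rr1 /econvexP cg gN fE phi0 cf; apply/econvexP => x y a b t fxa fyb /andP[].
rewrite le_eqVlt => /predU1P[<- _|t0].
  by rewrite scale0r subr0 scale1r !add0r mul0r mul1r add0r.
rewrite le_eqVlt => /predU1P[->|t1].
  by rewrite subrr scale0r scale1r addr0 mul1r mul0r addr0.
pose P (s : R) := s *: x + (1 - s) *: y.
have fP s : 0 <= s <= 1 -> f (P s) = (fine (f (P s)))%:E.
  move=> s01; rewrite fineK// fin_numE; apply/andP; split.
    by rewrite fE; move: (gN (P s)); case: (g (P s)).
  have gx : (g x <= (a - phi x)%:E)%E by rewrite EFinB leeBrDr// -fE.
  have gy : (g y <= (b - phi y)%:E)%E by rewrite EFinB leeBrDr// -fE.
  have := cg _ _ _ _ _ gx gy s01.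
  by rewrite fE; case: (g _).
pose l := quad_norm G (x - y).
have l0 : 0 <= l by exact: quad_norm_ge0.
have rr : 0 < r1 - r by rewrite subr_gt0.
(* Fine enough that two consecutive steps together move by less than [r1 - r] in the norm. *)
pose K := (Num.truncn (2 * l / (r1 - r))).+1.
have Kl : 2 * l / (r1 - r) < K%:R by rewrite /K truncnS_gt.
have K0 : 0 < K%:R :> R by rewrite ltr0n.
have {}Kl : (K%:R^-1 + K%:R^-1) * l < r1 - r.
  rewrite [X in X < _](_ : _ = 2 * l / K%:R); last by ring.
  by rewrite ltr_pdivrMr// [ltRHS]mulrC -ltr_pdivrMr.
have [|//|s [s0 sK s2K s01 sstep]] := @exists_mesh t K; first by rewrite t0.
pose D i := fine (f (P (s i))) - (s i * a + (1 - s i) * b).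
suff : D K <= 0.
  by rewrite /D sK subr_le0 -lee_fin -fP// !ltW.
apply: (@discrete_max_principle _ D (K + K)); last by rewrite leq_addr.
- have P0 : P 0 = y by rewrite /P scale0r subr0 scale1r add0r.
  rewrite /D s0 P0 subr0 mul0r mul1r add0r subr_le0 -lee_fin.
  by rewrite -P0 -fP ?P0// lexx ler01.
- have P1 : P 1 = x by rewrite /P subrr scale0r scale1r addr0.
  rewrite /D s2K P1 subrr mul0r mul1r addr0 subr_le0 -lee_fin.
  by rewrite -P1 -fP ?P1// lexx ler01.
case=> // j /= jK.
have [al [be [/andP[al0 alK] /andP[be0 beK] sE1 sE2]]] := sstep j.
have ab0 : 0 < al + be by lra.
pose la := be / (al + be).
have la01 : 0 < la < 1.
  by rewrite /la divr_gt0//= ltr_pdivrMr// mul1r ltrDr.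
exists la; split => //.
have sj : s j.+1 = la * s j + (1 - la) * s j.+2.
  by rewrite sE2 sE1 /la; field; rewrite gt_eqF.
set u := P (s j); set v := P (s j.+2); set w := P (s j.+1).
have wE : w = la *: u + (1 - la) *: v.
  by rewrite /w /u /v /P sj; apply/rowP => i; rewrite !mxE; ring.
have s1 := s01 j (ltnW (ltnW jK)); have s2 := s01 j.+1 (ltnW jK); have s3 := s01 j.+2 jK.
suff : fine (f w) <= la * fine (f u) + (1 - la) * fine (f v).
  rewrite /D -/u -/v -/w; rewrite {1}sj; move=> h.
  have -> : la * (fine (f u) - (s j * a + (1 - s j) * b)) +
    (1 - la) * (fine (f v) - (s j.+2 * a + (1 - s j.+2) * b)) =
    la * fine (f u) + (1 - la) * fine (f v) - ((la * s j + (1 - la) * s j.+2) * a +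
    (1 - (la * s j + (1 - la) * s j.+2)) * b) by ring.
  by rewrite sj; lra.
have la01' : 0 <= la <= 1 by case/andP: la01 => ? ?; rewrite !ltW.
have Nuv : quad_norm G (u - v) < r1 - r.
  apply: le_lt_trans Kl.
  have -> : u - v = (- (al + be)) *: (x - y).
    by rewrite /u /v /P sE2 sE1; apply/rowP => i; rewrite !mxE; ring.
  rewrite quad_normZ// normrN gtr0_norm// ler_wpM2r//; lra.
have Ntri z z' : N z <= N z' + quad_norm G (z - z').
  have -> : z - x0 = (z' - x0) + (z - z') by apply/rowP => i; rewrite !mxE; ring.
  exact: quad_normD.
have Nsym z z' : quad_norm G (z - z') = quad_norm G (z' - z).
  by rewrite -opprB -scaleN1r quad_normZ// normrN1 mul1r.
have uw : quad_norm G (u - w) <= quad_norm G (u - v).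
  have -> : u - w = (1 - la) *: (u - v) by rewrite wE; apply/rowP => i; rewrite !mxE; ring.
  by case/andP: la01' => ? ?; rewrite quad_normZ// ger0_norm ?ler_piMl ?quad_norm_ge0//; lra.
have vw : quad_norm G (v - w) <= quad_norm G (u - v).
  have -> : v - w = (- la) *: (u - v) by rewrite wE; apply/rowP => i; rewrite !mxE; ring.
  by case/andP: la01' => ? ?; rewrite quad_normZ// normrN ger0_norm// ler_piMl ?quad_norm_ge0.
(* All three points then lie where [phi] vanishes, and the inequality is that of [g]. *)
have far : r1 <= N u \/ r1 <= N v -> (f w <= (la * fine (f u) + (1 - la) * fine (f v))%:E)%E.
  move=> far; have [ru rv rw] : [/\ r <= N u, r <= N v & r <= N w].
    have := Ntri v u; rewrite (Nsym v u) => vu.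
    exact: (outer_points Nuv uw vw (Ntri u v) vu (Ntri u w) (Ntri v w) far).
  have gf z : r <= N z -> g z = f z by move=> /phi0 z0; rewrite fE z0 adde0.
  rewrite -gf// wE; apply: cg => //; rewrite gf//.
    by rewrite -(fP _ s1).
  by rewrite -(fP _ s3).
rewrite -lee_fin -(fP _ s2) -/w.
have [Nu|Nu] := ltP (N u) r1; last by apply: far; left.
have [Nv|Nv] := ltP (N v) r1; last by apply: far; right.
rewrite wE; apply: cf => //.
  by rewrite -(fP _ s1).
by rewrite -(fP _ s3).
Qed.

(** On the ellipsoid [f] is [qc] plus a convex radial function: the strongly convex part of [g] is
    exactly what absorbs the bump. *)
Lemma bump_convex_on_ellipsoid (g q f : 'rV[R]_d -> \bar R) (r r1 e del : R) :
  0 <= r -> econvex q ->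
  (forall x, N x < r1 -> g x = ((2^-1 * quad_form G (x - x0))%:E + q x)%E) ->
  (forall x, f x = (g x + (bump r e del (N x))%:E)%E) ->
  convex_on_ellipsoid f r1.
Proof.
move=> r0 /econvexP cq gE fE x y a b t Nx Ny fxa fyb t01.
have Nz := quad_norm_conv Gpos x0 x y t01.
set z := t *: x + (1 - t) *: y in Nz *.
have Nzr : N z < r1.
  apply: (le_lt_trans Nz); case/andP: t01 => t0 t1.
  have [->|tn0] := eqVneq t 0; first by rewrite mul0r add0r subr0 mul1r.
  have h1 : t * N x < t * r1 by rewrite ltr_pM2l// lt_neqAle eq_sym tn0.
  have h2 : (1 - t) * N y <= (1 - t) * r1 by rewrite ler_wpM2l ?subr_ge0// ltW.
  lra.
pose F x := 2^-1 * N x ^+ 2 + bump r e del (N x).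
have fF x' : N x' < r1 -> f x' = (q x' + (F x')%:E)%E.
  move=> Nx'; rewrite fE gE// /F quad_norm_sqr// EFinD addeA; congr (_ + _)%E.
  by rewrite addeC.
have qx : (q x <= (a - F x)%:E)%E by rewrite EFinB leeBrDr// -fF.
have qy : (q y <= (b - F y)%:E)%E by rewrite EFinB leeBrDr// -fF.
have qz := cq _ _ _ _ _ qx qy t01; rewrite -/z in qz.
rewrite fF//; apply: (le_trans (leeD2r _ qz)).
rewrite -EFinD lee_fin.
have := bump_convex e del r0 (quad_norm_ge0 _ _) (quad_norm_ge0 _ _) (quad_norm_ge0 _ _) t01 Nz.
rewrite -/(F x) -/(F y) -/(F z); lra.
Qed.

Lemma continuous_bump (r e del : R) : continuous (bump r e del).
Proof.
have cc (c : R) : continuous (cst c : R -> R) by exact: cst_continuous.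
have ci : continuous (id : R -> R) by move=> s; exact: cvg_id.
have cm : continuous (fun s : R => Num.max (r - s) 0).
  apply: (@max_fun_continuous _ R R); last exact: cc.
  by move=> s; exact: (continuousB (cc r s) (ci s)).
apply: (@max_fun_continuous _ R R); first apply: (@max_fun_continuous _ R R).
- exact: cc.
- by move=> s; exact: (continuousN (continuousM (cc _ s) (continuousM (cm s) (cm s)))).
- by move=> s; exact: (continuousB (cc _ s)
    (continuousM (cc _ s) (continuousM (ci s) (ci s)))).
Qed.

Lemma continuous_bump_norm (r e del : R) :
  continuous (fun x : 'rV[R]_d => bump r e del (N x)).
Proof.
move=> x; apply: (@continuous_comp _ _ _ (fun x : 'rV[R]_d => N x) (bump r e del)).
  exact: continuous_quad_norm.
exact: continuous_bump.
Qed.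

End local_perturbation.

(** * Convex functions near an interior point of the domain *)

Section semicontinuity.
Context (R : realType) (d : nat).
Implicit Types (g : 'rV[R]_d -> \bar R) (x : 'rV[R]_d).

Lemma lower_semicontinuous_addr g (phi : 'rV[R]_d -> R) :
  (forall x, g x != -oo%E) -> lower_semicontinuous g -> continuous phi ->
  lower_semicontinuous (fun x => g x + (phi x)%:E)%E.
Proof.
move=> gN lg cphi x a ag.
have [b ab bg] : exists2 b : R, a - phi x < b & (b%:E < g x)%E.
  move: (gN x) ag; case: (g x) => [s| |]//.
    rewrite -EFinD lte_fin => _ as_; exists ((a - phi x + s) / 2); rewrite ?lte_fin; lra.
  by move=> _ _; exists (a - phi x + 1); rewrite ?ltry// ltrDl.
have [V xV Vg] := lg _ _ bg.
have [W xW Wphi] : exists2 W, nbhs x W & forall y, W y -> a - b < phi y.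
  exists [set y | a - b < phi y] => //.
  have := cphi x; move/cvgr_gt; apply; lra.
exists (V `&` W); first exact: filterI.
move=> y [Vy Wy].
have h1 := Vg _ Vy; have h2 := Wphi _ Wy.
apply: (@lt_le_trans _ _ (b + phi y)%:E); first by rewrite lte_fin; lra.
by rewrite EFinD leeD2r// ltW.
Qed.

Lemma nbhs_boxP x (A : set 'rV[R]_d) :
  nbhs x A <-> exists2 e : R, 0 < e &
    forall y : 'rV[R]_d, (forall i, `|y ord0 i - x ord0 i| < e) -> A y.
Proof.
split=> [/nbhs_ballP[e e0 xA]|[e e0 xA]].
  exists e => // y xy; apply: xA; split=> // i j.
  by rewrite !ord1 /ball/= distrC; exact: xy.
apply/nbhs_ballP; exists e => //= y [_ xy]; apply: xA => i.
by rewrite distrC; exact: (xy ord0 i).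
Qed.

Lemma econvex_ray_le g x0 (y0 rho : R) (v : 'rV[R]_d) : econvex g ->
  g x0 = y0%:E -> (g (x0 + v)%R < +oo)%E -> 0 < rho ->
  exists2 e : R, 0 < e &
    forall s : R, 0 <= s <= e -> (g (x0 + s *: v)%R <= (y0 + rho)%:E)%E.
Proof.
move=> /econvexP cg gx0 gv rho0.
have [M gM] : exists M : R, (g (x0 + v)%R <= M%:E)%E.
  by move: gv; case: (g _) => [M _|//|_]; [exists M|exists 0; rewrite leNye].
pose e := Num.min 1 (rho / (`|M - y0| + 1)).
have p0 : 0 < `|M - y0| + 1 by rewrite ltr_wpDl.
have e0 : 0 < e by rewrite lt_min ltr01 divr_gt0.
exists e => // s /andP[s0 se].
have s1 : s <= 1 by rewrite (le_trans se)// ge_min lexx.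
have sr : s * (`|M - y0| + 1) <= rho.
  by rewrite -ler_pdivlMr// (le_trans se)// ge_min lexx orbT.
have -> : x0 + s *: v = s *: (x0 + v) + (1 - s) *: x0.
  by apply/rowP => i; rewrite !mxE; ring.
apply: (le_trans (cg _ _ M y0 _ gM _ _)); rewrite ?gx0 ?s0//.
rewrite lee_fin.
have : s * (M - y0) <= s * `|M - y0| by rewrite ler_wpM2l// ler_norm.
lra.
Qed.

(** Induction on the number [k] of coordinates in which the point may differ from [x0]. A
    displacement with one more coordinate is the midpoint of twice its old part and twice its new
    part; both ends satisfy the same bound, so nothing is lost at the midpoint. *)
Lemma econvex_usc g x0 (y0 rho : R) : econvex g -> g x0 = y0%:E ->
  (\forall x \near x0, (g x < +oo)%E) -> 0 < rho ->
  \forall x \near x0, (g x <= (y0 + rho)%:E)%E.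
Proof.
move=> cg gx0 /nbhs_boxP[tau tau0 gfin] rho0.
have fin_e (s : R) k : `|s| < tau -> (g (x0 + s *: delta_mx ord0 k)%R < +oo)%E.
  move=> st; apply: gfin => i; rewrite !mxE addrAC subrr add0r normrM.
  by case: (_ && _); rewrite ?normr1 ?normr0 ?mulr1 ?mulr0.
suff H k : exists2 e : R, 0 < e & forall u : 'rV[R]_d,
    (forall i : 'I_d, (k <= i)%N -> u ord0 i = 0) ->
    (forall i, `|u ord0 i| < e) -> (g (x0 + u)%R <= (y0 + rho)%:E)%E.
  have [e e0 He] := H d.
  apply/nbhs_boxP; exists e => // y xy.
  rewrite -[y](subrK x0) addrC; apply: He => i; last by rewrite !mxE.
  by rewrite leqNgt ltn_ord.
elim: k => [|k [e e0 IH]].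
  exists 1 => // u u0 _.
  have -> : u = 0 by apply/rowP => i; rewrite u0// mxE.
  by rewrite addr0 gx0 lee_fin; lra.
have [kd|kd] := ltnP k d; last first.
  exists e => // u uk ue; apply: IH => // i ki.
  by move: (ltn_ord i); rewrite ltnNge (leq_trans kd ki).
pose K := Ordinal kd.
have tau20 : `|tau / 2| < tau by rewrite ger0_norm ?divr_ge0 ?ltW//; lra.
have [e1 e10 H1] := econvex_ray_le cg gx0 (fin_e _ K tau20) rho0.
have [e2 e20 H2] := econvex_ray_le cg gx0 (fin_e _ K (etrans (congr1 (fun z => z < tau) (normrN _)) tau20)) rho0.
(* The last factors [/ 2] allow for the doubling; [e1] and [e2] serve the two signs of the new
   coordinate, measured in units of [tau / 2]. *)
pose e' := Num.min (e / 2) (Num.min (e1 * (tau / 2) / 2) (e2 * (tau / 2) / 2)).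
have tau2 : 0 < tau / 2 by lra.
exists e'; first by rewrite !lt_min !divr_gt0 ?mulr_gt0.
move=> u uk ue.
pose s := u ord0 K.
pose u' : 'rV[R]_d := u - s *: delta_mx ord0 K.
have u'i i : u' ord0 i = if i == K then 0 else u ord0 i.
  rewrite !mxE eqxx/=; case: eqP => [->|_]; first by rewrite mulr1 subrr.
  by rewrite mulr0 subr0.
have gu' : (g (x0 + 2 *: u')%R <= (y0 + rho)%:E)%E.
  apply: IH => i.
    move=> ki; rewrite mxE u'i; case: eqP => [_|/eqP iK]; first by rewrite mulr0.
    rewrite uk ?mulr0// ltn_neqAle ki andbT.
    by apply: contra iK => /eqP kE; apply/eqP/val_inj.
  rewrite mxE normrM ger0_norm// u'i; case: eqP => _; first by rewrite normr0 mulr0.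
  have := ue i; rewrite lt_min => /andP[? _]; lra.
have gs : (g (x0 + (2 * s) *: delta_mx ord0 K)%R <= (y0 + rho)%:E)%E.
  have := ue K; rewrite -/s !lt_min => /and3P[_ se1 se2].
  have [s0|s0] := leP 0 s.
    have := H1 (2 * s / (tau / 2)); rewrite scalerA divfK ?gt_eqF//; apply.
    rewrite ger0_norm// in se1.
    apply/andP; split; first exact: divr_ge0 (mulr_ge0 (ler0n _ 2) s0) (ltW tau2).
    by rewrite ler_pdivrMr//; lra.
  have := H2 (- (2 * s) / (tau / 2)); rewrite scalerA.
  have -> : - (2 * s) / (tau / 2) * - (tau / 2) = 2 * s.
    by rewrite mulrN divfK ?gt_eqF// opprK.
  apply; rewrite ltr0_norm// in se2.
  apply/andP; split; last by rewrite ler_pdivrMr//; lra.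
  by apply: divr_ge0 (ltW tau2); lra.
have -> : x0 + u = 2^-1 *: (x0 + 2 *: u') + (1 - 2^-1) *: (x0 + (2 * s) *: delta_mx ord0 K).
  by apply/rowP => i; rewrite /u' !mxE; field.
move/econvexP : cg => cg.
apply: (le_trans (cg _ _ _ _ _ gu' gs _)); first by apply/andP; split; lra.
by rewrite lee_fin; lra.
Qed.

(** The upper bound comes from convexity, the lower one from closedness. *)
Lemma closed_proper_convex_near g x0 (y0 rho : R) : closed_proper_convex g ->
  g x0 = y0%:E -> (\forall x \near x0, (g x < +oo)%E) -> 0 < rho ->
  \forall x \near x0, g x = (fine (g x))%:E /\ `|fine (g x) - y0| <= rho.
Proof.
move=> [cg [gN _] lg] gx0 gfin rho0.
have gu := econvex_usc cg gx0 gfin rho0.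
have [|V xV Vg] := lg x0 (y0 - rho); first by rewrite gx0 lte_fin; lra.
near=> x.
have h1 : (g x <= (y0 + rho)%:E)%E by near: x.
have h2 : ((y0 - rho)%:E < g x)%E by apply: Vg; near: x.
move: h1 h2; case: (g x) => //= s; rewrite lee_fin lte_fin => ? ?; split=> //.
by rewrite ler_norml; apply/andP; split; lra.
Unshelve. all: by end_near. Qed.

End semicontinuity.

Section interior.
Context (R : realType) (d : nat).

Lemma affine_hull_orthant : affine_hull (@orthant R d) = setT.
Proof.
apply/seteqP; split => // y _ B [affB oB].
(* The negative part of [y]; then [y + b] is the positive part, and [y] lies on the line through two
   points of the orthant. *)
pose b : 'rV[R]_d := \row_i Num.max (- y ord0 i) 0.
pose a : 'rV[R]_d := 2^-1 *: (y + b).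
have -> : y = 2 *: a + (1 - 2) *: b.
  by rewrite /a; apply/rowP => i; rewrite !mxE; field.
apply: affB; apply: oB => i; rewrite !mxE ?le_max ?lexx ?orbT//.
rewrite mulr_ge0// addrC -lerBlDr sub0r le_max lexx//.
Qed.

Lemma affine_hull_full (A : set 'rV[R]_d) : has_affine_dim A d -> affine_hull A = setT.
Proof.
move=> [x [V [-> dV]]].
have -> : V = fullv.
  by apply/eqP; rewrite eqEdim subvf dimvf dV /dim/= mul1n.
by apply/seteqP; split => // y _; rewrite /= memvf.
Qed.

(** In both cases the affine hull of the domain is the whole space, so the relative interior is the
    interior. *)
Lemma relint_dom_near m (g : 'rV[R]_d -> \bar R) x0 : admissible m g ->
  relint (dom g) x0 -> \forall x \near x0, (g x < +oo)%E.
Proof.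
move=> [_ domg] [_]; have -> : affine_hull (dom g) = setT.
  case: m domg => [->|]; [exact: affine_hull_orthant|exact: affine_hull_full].
by apply: filterS => x; apply.
Qed.

Lemma relint_density_domain m (g : 'rV[R]_d -> \bar R) x : admissible m g ->
  (g x < +oo)%E -> density_domain m x.
Proof. by move=> [_]; case: m => //= <-. Qed.

End interior.

(** * The transformation near g(x0) *)

Section slopes.
Context (R : realType).
Implicit Types (h : \bar R -> \bar R) (y z rho : R).

Definition direction m : R := if m is Increasing then 1 else -1.

Lemma direction_sqr m : direction m * direction m = 1.
Proof. by case: m; rewrite /direction; ring. Qed.

Lemma normr_direction m : `|direction m| = 1.
Proof. by case: m; rewrite /= ?normrN normr1. Qed.

Lemma transformation_homo m d h (x y : \bar R) : transformation m d h ->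
  (x <= y)%E -> match m with Increasing => (h x <= h y)%E | Decreasing => (h y <= h x)%E end.
Proof. by case: m => th xy; [exact: (incr_mono th)|exact: (decr_mono th)]. Qed.

(** The three clauses serve in turn to bound the denominator of the chi-square divergence from
    below, to compare changes of density with changes of [g] on both sides, and to make the
    functional well defined. In the last one [y] is any extended real, as other representations of a
    density are not known to stay near [y0]. *)
Definition slope_controlled m h y0 rho : Prop :=
  let a := `|derive1 (fin_part h) y0| in
  [/\ forall z, `|z - y0| <= rho ->
        h z%:E = (fin_part h z)%:E /\ fin_part h y0 / 2 <= fin_part h z,
      forall z z', `|z - y0| <= rho -> `|z' - y0| <= rho -> z <= z' ->
        a / 2 * (z' - z) <= direction m * (fin_part h z' - fin_part h z) <=
        2 * a * (z' - z) &
      forall z (y : \bar R), `|z - y0| < rho -> h y = h z%:E -> y = z%:E].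

Lemma slope_controlled_near m d h y0 : transformation m d h -> C1_at h y0 ->
  (0 < h y0%:E)%E -> derive1 (fin_part h) y0 != 0 ->
  exists2 rho : R, 0 < rho & slope_controlled m h y0 rho.
Proof.
move=> th hC1 h0 hn0.
set k := fin_part h; set a := `|derive1 k y0|.
have a0 : 0 < a by rewrite normr_gt0.
have kh0 : 0 < k y0.
  have [hfin _ _] := nbhs_singleton hC1.
  by rewrite -lte_fin /k /fin_part fineK.
have /nbhs_ballP[e0 /= e00 He0] := hC1.
have [_ _ ck] := nbhs_singleton hC1.
have a20 : 0 < a / 2 by rewrite divr_gt0.
have : \forall z \near y0, `|derive1 k y0 - derive1 k z| < a / 2.
  by move/cvgr_dist_lt : ck; apply.
move=> /nbhs_ballP[e1 /= e10 He1].
(* The last bound gives [2 * a * rho <= k y0 / 2], so [h] keeps half of its value. *)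
pose rho := Num.min (Num.min (e0 / 2) (e1 / 2)) (k y0 / (4 * a)).
have rho0 : 0 < rho by rewrite !lt_min !divr_gt0// mulr_gt0.
have near z : `|z - y0| <= rho -> [/\ h z%:E = (k z)%:E, is_derive z 1 k (derive1 k z)
    & `|derive1 k y0 - derive1 k z| < a / 2].
  rewrite !le_min => /andP[/andP[z0 z1] _].
  have zb0 : ball y0 e0 z by rewrite /ball/= distrC; lra.
  have zb1 : ball y0 e1 z by rewrite /ball/= distrC; lra.
  have [hz dz _] := He0 z zb0; split.
  - by rewrite /k /fin_part fineK.
  - by apply: DeriveDef => //; rewrite derive1E.
  - exact: He1 zb1.
pose s0 := Num.sg (derive1 k y0).
have s0a : s0 * derive1 k y0 = a by rewrite /s0 /a normrEsg.
have s0n : `|s0| = 1 by rewrite /s0 normr_sg hn0.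
have slope z z' : `|z - y0| <= rho -> `|z' - y0| <= rho -> z <= z' ->
    a / 2 * (z' - z) <= s0 * (k z' - k z) <= 2 * a * (z' - z).
  move=> zr z'r zz'.
  have between c : z <= c <= z' -> `|c - y0| <= rho.
    move=> /andP[zc cz]; rewrite ler_norml.
    by move: zr z'r; rewrite !ler_norml => /andP[? ?] /andP[? ?]; apply/andP; split; lra.
  have [c|c|c] := @MVT_segment R k (derive1 k) z z' zz'.
  - by rewrite in_itv/= => /andP[/ltW ? /ltW ?]; have [] := near c (between _ _); rewrite ?zc//; apply/andP.
  - apply: continuous_in_subspaceT => c'; rewrite inE/= in_itv/= => /between/near[_ dc _].
    exact/differentiable_continuous/derivable1_diffP/ex_derive.
  rewrite in_itv/= => /between/near[_ _ dc] ->.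
  have : `|s0 * derive1 k y0 - s0 * derive1 k c| < a / 2.
    by rewrite -mulrBr normrM s0n mul1r.
  rewrite s0a ltr_distl mulrA => /andP[d1 d2].
  by apply/andP; split; rewrite ler_wpM2r ?subr_ge0//; lra.
have near0 : `|y0 - y0| <= rho by rewrite subrr normr0 ltW.
have near1 : `|y0 + rho - y0| <= rho by rewrite addrC addKr ger0_norm// ltW.
(* Near [y0] the values of [h] move strictly with the sign of the derivative, and monotonicity
   leaves one sign. *)
have s0E : s0 = direction m.
  have y01 : y0 <= y0 + rho by rewrite lerDl ltW.
  have /andP[d1 _] := slope _ _ near0 near1 y01.
  have d2 : 0 < s0 * (k (y0 + rho) - k y0).
    by apply: lt_le_trans d1; rewrite mulr_gt0//; lra.
  have := @transformation_homo m d h y0%:E (y0 + rho)%:E th; rewrite lee_fin => /(_ y01).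
  have [-> _ _] := near _ near0; have [-> _ _] := near _ near1.
  move: s0n d2; rewrite /s0; case: sgrP => _; rewrite ?normr0.
  - by move/esym/eqP; rewrite oner_eq0.
  - by case: m {th} => // _ d2; rewrite lee_fin; lra.
  - by case: m {th} => // _ d2; rewrite lee_fin; lra.
exists rho => //; rewrite /slope_controlled -/k -/a -s0E; split => //.
- move=> z zr; have [hz _ _] := near z zr; split => //.
  have : `|s0 * (k z - k y0)| <= 2 * a * rho.
    have [zy|/ltW yz] := leP z y0.
      have /andP[d1 d2] := slope _ _ zr near0 zy.
      rewrite -normrN -mulrN opprB ger0_norm; last first.
        by apply: le_trans d1; rewrite mulr_ge0 ?subr_ge0// ltW.
      apply: (le_trans d2); rewrite ler_wpM2l ?mulr_ge0 ?(ltW a0)//.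
      by move: zr; rewrite ler_norml => /andP[]; lra.
    have /andP[d1 d2] := slope _ _ near0 zr yz.
    rewrite ger0_norm; last first.
      by apply: le_trans d1; rewrite mulr_ge0 ?subr_ge0// ltW.
    apply: (le_trans d2); rewrite ler_wpM2l ?mulr_ge0 ?(ltW a0)//.
    by move: zr; rewrite ler_norml => /andP[]; lra.
  rewrite normrM s0n mul1r ler_norml => /andP[d1 _].
  have : 2 * a * rho <= k y0 / 2.
    have : rho <= k y0 / (4 * a) by rewrite /rho ge_min lexx orbT.
    rewrite ler_pdivlMr ?mulr_gt0// => h4; lra.
  by lra.
- have strict z z' : `|z - y0| <= rho -> `|z' - y0| <= rho -> z < z' -> h z%:E != h z'%:E.
    move=> zr z'r zz'; have [-> _ _] := near _ zr; have [-> _ _] := near _ z'r.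
    have /andP[d1 _] := slope _ _ zr z'r (ltW zz').
    apply/eqP => -[kzz']; move: d1; rewrite kzz' subrr mulr0.
    by rewrite leNgt mulr_gt0// subr_gt0.
  move=> z y zr hyz.
  have zr' := ltW zr.
  move: zr; rewrite ltr_norml => /andP[z1 z2].
  (* If [h] agreed at [z] and at another point, it would be constant between them; a point in
     between that is still within [rho] of [y0] contradicts [strict]. *)
  have squeeze (u v w : \bar R) : (u <= v)%E -> (v <= w)%E -> h u = h w -> h v = h u.
    move=> uv vw huw; have := transformation_homo th uv; have := transformation_homo th vw.
    by rewrite -huw; case: (m) => h1 h2; apply/eqP; rewrite eq_le; apply/andP; split.
  apply/eqP; rewrite eq_le; apply/andP; split; rewrite leNgt; apply/negP => yz.
  + have [w zw [wy wr]] : exists2 w, z < w & (w%:E <= y)%E /\ w <= y0 + rho.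
      move: yz; case: y {hyz} => [y| |]//; rewrite ?lte_fin => yz.
        exists (Num.min y (y0 + rho)); first by rewrite lt_min yz; lra.
        by rewrite lee_fin !ge_min !lexx orbT.
      by exists (y0 + rho); [lra|rewrite leey].
    have wn : `|w - y0| <= rho by rewrite ler_norml; apply/andP; split; lra.
    move/eqP: (strict z w zr' wn zw); apply.
    by rewrite (squeeze z%:E w%:E y) ?lee_fin ?(ltW zw).
  + have [w zw [wy wr]] : exists2 w, w < z & (y <= w%:E)%E /\ y0 - rho <= w.
      move: yz; case: y {hyz} => [y| |]//; rewrite ?lte_fin => yz.
        exists (Num.max y (y0 - rho)); first by rewrite gt_max yz; lra.
        by rewrite lee_fin !le_max !lexx orbT.
      by exists (y0 - rho); [lra|rewrite leNye].
    have wn : `|w - y0| <= rho by rewrite ler_norml; apply/andP; split; lra.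
    move/eqP: (strict w z wn zr' zw); apply.
    by rewrite (squeeze y w%:E z%:E) ?lee_fin ?(ltW zw).
Qed.

End slopes.

(** * Measurability and balancing of mass *)

Section measure_lemmas.
Context (dsp : measure_display) (T : measurableType dsp) (R : realType).

(** For a level [c] in the range, [f > c] is the same as [p > k c]. This supplies the measurability
    of [g] near [x0] from that of the density. *)
Lemma measurable_fun_strictly_increasing (D : set T) (f p : T -> R) (k : R -> R) (l u : R) :
  measurable_fun D p -> (forall x, D x -> l <= f x <= u) ->
  (forall x, D x -> p x = k (f x)) ->
  (forall z z', l <= z -> z < z' -> z' <= u -> k z < k z') -> measurable_fun D f.
Proof.
move=> mp flu pk kinc mD; apply: (measurability _ (RGenOInfty.measurableE R)) => //.
move=> /= _ [_ [c ->] <-].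
have [cl|lc] := ltP c l.
  rewrite [X in measurable X](_ : _ = D)//; apply/seteqP; split => x; first by case.
  by move=> Dx; split => //=; rewrite in_itv/= andbT (lt_le_trans cl)//; case/andP: (flu x Dx).
have [uc|cu] := leP u c.
  rewrite [X in measurable X](_ : _ = set0)//; apply/seteqP; split => x//.
  move=> [Dx] /=; rewrite in_itv/= andbT; case/andP: (flu x Dx) => _ fu.
  by rewrite ltNge (le_trans fu).
rewrite [X in measurable X](_ : _ = D `&` p @^-1` `]k c, +oo[%classic).
  by apply: mp => //; exact: measurable_itv.
apply/seteqP; split => x [Dx] /=; rewrite !in_itv/= !andbT pk// => cf; split => //=;
  rewrite ?in_itv/= ?andbT ?pk//; case/andP: (flu x Dx) => lf fu.
  exact: kinc.
rewrite ltNge; apply/negP => fc; move: cf; rewrite ltNge; apply/negP; rewrite negbK.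
move: fc; rewrite le_eqVlt => /predU1P[->//|fc].
by rewrite ltW// kinc// ltW.
Qed.

Variable mu : {measure set T -> \bar R}.

Lemma bounded_integrable (B : set T) (f : T -> R) (M : R) : measurable B ->
  (mu B < +oo)%E -> measurable_fun B f -> (forall x, B x -> `|f x| <= M) ->
  mu.-integrable B (EFin \o f).
Proof.
move=> mB muB mf fM; apply: measurable_bounded_integrable => //.
exists M; split; first exact: num_real.
by move=> K MK x Bx; exact: (le_trans (fM x Bx)) (ltW MK).
Qed.

Lemma lipschitz_continuous (F : R -> R) (K : R) :
  (forall s t, s <= t -> `|F s - F t| <= K * (t - s)) -> continuous F.
Proof.
move=> FK t; apply/cvgrPdist_le => e e0.
have K1 : 0 < `|K| + 1 by rewrite ltr_wpDl.
have eK : 0 < e / (`|K| + 1) by rewrite divr_gt0.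
have : \forall s \near t, `|t - s| < e / (`|K| + 1).
  exact: (nbhsx_ballx t _ eK).
apply: filterS => s; rewrite ltr_pdivlMr// => ts.
have KK : K * `|t - s| <= (`|K| + 1) * `|t - s|.
  by rewrite ler_wpM2r// (le_trans (ler_norm K))// lerDl.
apply: le_trans (_ : K * `|t - s| <= _); last by rewrite (le_trans KK)// mulrC ltW.
have [st|/ltW ts'] := leP s t.
  by rewrite distrC (ger0_norm (_ : 0 <= t - s)) ?subr_ge0//; exact: FK.
by rewrite (distrC t) (ger0_norm (_ : 0 <= s - t)) ?subr_ge0//; exact: FK.
Qed.

(** The mass of [W 0] is at least that of [b]; at [d1] the possible gain on [E] is outweighed by the
    loss on [A]. The mass is Lipschitz in the parameter, so an intermediate value balances. *)
Lemma exists_balanced (B E A : set T) (W : R -> T -> R) (b : T -> R) (M K d1 c1 c2 : R) :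
  measurable B -> measurable E -> measurable A -> E `<=` B -> A `<=` B ->
  (mu B < +oo)%E -> 0 <= d1 ->
  (forall del, measurable_fun B (W del)) -> measurable_fun B b ->
  (forall del x, B x -> `|W del x| <= M) -> (forall x, B x -> `|b x| <= M) ->
  (forall del del' x, del <= del' -> B x -> `|W del x - W del' x| <= K * (del' - del)) ->
  (forall x, B x -> b x <= W 0 x) ->
  (forall x, B x -> W d1 x <= b x + (c1 * \1_E x - c2 * \1_A x)) ->
  c1 * fine (mu E) <= c2 * fine (mu A) ->
  exists2 del, 0 <= del <= d1 & \int[mu]_(x in B) W del x = \int[mu]_(x in B) b x.
Proof.
move=> mB mE mA EB AB muB d10 mW mb WM bM WK bW Wb cEA.
pose F del := \int[mu]_(x in B) W del x.
have iW del : mu.-integrable B (EFin \o W del).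
  by apply: (bounded_integrable (M := M)) => //; exact: WM.
have ib : mu.-integrable B (EFin \o b) by apply: (bounded_integrable (M := M)).
have i1 (S : set T) (c : R) : measurable S -> mu.-integrable B (EFin \o (fun x => c * \1_S x)).
  move=> mS; apply: (bounded_integrable (M := `|c|)) => //.
    by apply: measurable_funM => //; exact: measurable_indic.
  by move=> x _; rewrite normrM ler_piMr// indicE; case: (_ \in _); rewrite ?normr1 ?normr0.
have I1 (S : set T) (c : R) : measurable S -> S `<=` B ->
    \int[mu]_(x in B) (c * \1_S x) = c * fine (mu S).
  move=> mS SB; rewrite RintegralZl//.
    by rewrite /Rintegral integral_indic// (setIidl SB).
  apply: (bounded_integrable (M := 1)) => //.
  by move=> x _; rewrite indicE; case: (_ \in _); rewrite ?normr1 ?normr0.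
have Fc : continuous F.
  apply: (@lipschitz_continuous _ (K * fine (mu B))) => s t st.
  rewrite /F -RintegralB//.
  apply: (le_trans (le_normr_Rintegral _ _)) => //.
    exact: (integrableB _ (iW s) (iW t)).
  rewrite mulrAC -Rintegral_cst//; apply: le_Rintegral => //.
  - apply: (bounded_integrable (M := M + M)) => //.
      by apply: measurableT_comp => //; exact: measurable_funB.
    move=> x Bx; rewrite normr_id (le_trans (ler_normB _ _))//.
    by rewrite lerD// WM.
  - by apply: (bounded_integrable (M := `|K * (t - s)|)).
  - by move=> x Bx; exact: WK.
have F0 : \int[mu]_(x in B) b x <= F 0 by apply: le_Rintegral.
have F1 : F d1 <= \int[mu]_(x in B) b x.
  apply: (@le_trans _ _ (\int[mu]_(x in B) (b x + (c1 * \1_E x - c2 * \1_A x)))).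
    apply: le_Rintegral => //.
    exact: (integrableD _ ib (integrableB _ (i1 E c1 mE) (i1 A c2 mA))).
  rewrite RintegralD//; last exact: (integrableB _ (i1 E c1 mE) (i1 A c2 mA)).
  rewrite RintegralB//; [|exact: i1|exact: i1].
  by rewrite !I1//; lra.
have [||c cd Fcb] := @IVT R F 0 d1 (\int[mu]_(x in B) b x) d10.
- exact: continuous_subspaceT.
- by rewrite ge_min F1 orbT le_max F0.
by exists c.
Qed.

End measure_lemmas.

(** * The perturbed densities *)

Lemma slope_lipschitz (R : realType) m (h : \bar R -> \bar R) (y0 rho z z' : R) :
  slope_controlled m h y0 rho -> `|z - y0| <= rho -> `|z' - y0| <= rho ->
  `|fin_part h z' - fin_part h z| <= 2 * `|derive1 (fin_part h) y0| * `|z' - z|.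
Proof.
move=> [_ sl _] zr z'r; wlog zz' : z z' zr z'r / z <= z' => [W|].
  have [/W//|/ltW z'z] := leP z z'; first exact.
  by rewrite distrC (distrC z'); exact: W.
have /andP[d1 d2] := sl _ _ zr z'r zz'.
rewrite (ger0_norm (_ : 0 <= z' - z)) ?subr_ge0//.
rewrite (_ : `|_| = `|direction R m * (fin_part h z' - fin_part h z)|); last first.
  by rewrite normrM normr_direction mul1r.
rewrite ger0_norm//.
by apply: le_trans d1; rewrite mulr_ge0 ?subr_ge0// divr_ge0.
Qed.

Section perturbation.
Context (R : realType) (d : nat) (m : monotonicity) (h : \bar R -> \bar R).
Context (g qc : 'rV[R]_d -> \bar R) (p : 'rV[R]_d -> R) (x0 : 'rV[R]_d).
Context (G : 'M[R]_d) (y0 rho r r1 : R).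
Local Notation N x := (quad_norm G (x - x0)).
Local Notation hr := (fin_part h).
Local Notation a := `|derive1 (fin_part h) y0|.
Local Notation h0 := (fin_part h y0).
Local Notation pt := (d.-tuple (measurableTypeR R)).
Local Notation vol := (lebesgue_measureX R d).
Hypothesis Gpos : posdefmx G.
Hypothesis gp : represents m h g p.
Hypothesis hslope : slope_controlled m h y0 rho.
Hypotheses (rho0 : 0 < rho) (r0 : 0 < r) (rr1 : r < r1).
Hypothesis h00 : 0 < h0.
Hypothesis a0 : 0 < a.
Hypothesis qc_convex : econvex qc.
Hypothesis g_near : forall x, N x < r1 ->
  g x = (fine (g x))%:E /\ `|fine (g x) - y0| <= rho / 2.
Hypothesis g_decomp : forall x, N x < r1 ->
  g x = ((2^-1 * quad_form G (x - x0))%:E + qc x)%E.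
Hypothesis gx0 : g x0 = y0%:E.

Definition pert_fun e del x : \bar R := (g x + (bump r e del (N x))%:E)%E.

(** Outside the ellipsoid [p] is kept literally: the bump is zero there, while [g] may be infinite
    or the point may lie off the orthant. *)
Definition pert_density e del x : R :=
  if N x <= r then hr (fine (g x) + bump r e del (N x)) else p x.

Lemma quad_norm_lt_outer x : N x <= r -> N x < r1.
Proof. by move=> /le_lt_trans; apply. Qed.

Lemma density_domain_near x : N x <= r -> density_domain m x.
Proof.
move=> /quad_norm_lt_outer/g_near[gx _]; case: gp => admg _ _ _ _.
by apply: (relint_density_domain admg); rewrite gx ltry.
Qed.

Lemma density_near x : N x <= r -> p x = hr (fine (g x)).
Proof.
move=> Nx; case: gp => _ pE _ _ _; have [gx _] := g_near (quad_norm_lt_outer Nx).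
by rewrite /fin_part -gx -pE//; exact: density_domain_near.
Qed.

Section parameters.
Context (e del : R).
Hypotheses (del0 : 0 <= del) (dele : del <= e) (erho : e <= rho / 4)
  (er : 2 * e <= r ^+ 2).

Let e0 : 0 <= e. Proof. exact: le_trans dele. Qed.

Lemma bump_norm_le s : `|bump r e del s| <= rho / 4.
Proof.
rewrite ler_norml (le_trans (bump_le _ _ _ _))// andbT.
by move: dele erho (bump_ge r e del s) => ? ? ?; lra.
Qed.

Lemma bump_out x : r <= N x -> bump r e del (N x) = 0.
Proof. by move=> rx; apply: bump_eq0 => //; exact: ltW. Qed.

Lemma in_range x : N x <= r ->
  `|fine (g x) - y0| <= rho /\ `|fine (g x) + bump r e del (N x) - y0| <= rho.
Proof.
move=> /quad_norm_lt_outer/g_near[_ gx]; have := bump_norm_le (N x).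
move: gx; rewrite !ler_norml => /andP[? ?] /andP[? ?].
by split; apply/andP; split; lra.
Qed.

Lemma pert_fun_x0 : pert_fun e del x0 = (y0 + e)%:E.
Proof. by rewrite /pert_fun gx0 subrr (quad_norm0 Gpos) bump0. Qed.

Lemma pert_density_bounds x : N x <= r ->
  h0 / 2 <= pert_density e del x /\ pert_density e del x <= h0 + 2 * a * rho.
Proof.
move=> Nx; rewrite /pert_density Nx; have [_ gb] := in_range Nx.
have [s1 s2 _] := hslope; have [_ ?] := s1 _ gb; split => //.
have y00 : `|y0 - y0| <= rho by rewrite subrr normr0 ltW.
have := slope_lipschitz hslope y00 gb.
have : 2 * a * `|fine (g x) + bump r e del (N x) - y0| <= 2 * a * rho.
  by rewrite ler_wpM2l// mulr_ge0.
by set z := hr (_ + _); have := ler_norm (z - h0); lra.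
Qed.

Lemma pert_density_dist x : N x <= r ->
  `|pert_density e del x - p x| <= 2 * a * `|bump r e del (N x)|.
Proof.
move=> Nx; rewrite /pert_density Nx density_near//; have [ga gb] := in_range Nx.
by have := slope_lipschitz hslope ga gb; rewrite addrAC subrr add0r.
Qed.

(** The bump is real valued, so the effective domain is that of [g], and the orthant or dimension
    condition is inherited. *)
Lemma pert_represents :
  density (pert_density e del) -> represents m h (pert_fun e del) (pert_density e del).
Proof.
move=> dq; case: (gp) => [[[cg [gN g1] lg] domg] pE p0 _ [M pM]].
have domE : dom (pert_fun e del) = dom g.
  by apply/seteqP; split => z; rewrite /dom /pert_fun/=; case: (g z) => [s| |] //=;
    rewrite !ltry.
have fN x : pert_fun e del x != -oo%E by rewrite /pert_fun; move: (gN x); case: (g x).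
split => //.
- split; last by case: (m) domg; rewrite domE.
  split.
  + apply: (econvex_glue Gpos rr1 cg gN (phi := fun x => bump r e del (N x))) => //.
      exact: bump_out.
    exact: (bump_convex_on_ellipsoid Gpos (ltW r0) qc_convex g_decomp).
  + by split => //; rewrite domE.
  + by apply: lower_semicontinuous_addr => //; exact: continuous_bump_norm.
- move=> x dx; rewrite /pert_density /pert_fun; case: ifP => Nx.
    have [gE _] := g_near (quad_norm_lt_outer Nx); rewrite gE -EFinD.
    have [_ gb] := in_range Nx; have [s1 _ _] := hslope.
    by have [-> _] := s1 _ gb.
  by rewrite pE// bump_out ?adde0// ltW// ltNge Nx.
- move=> x dx; rewrite /pert_density; case: ifP => [/density_domain_near//|_].
  exact: p0.
- exists (Num.max M (h0 + 2 * a * rho)) => x; rewrite le_max.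
  have [Nx|Nx] := leP (N x) r; last by rewrite /pert_density ifN -?ltNge// pM.
  by have [_ ->] := pert_density_bounds Nx; rewrite orbT.
Qed.

End parameters.

Local Notation B := [set t : pt | quad_form G (row_of t - x0) <= r ^+ 2].

Lemma in_ellipsoidP t : B t <-> N (row_of t) <= r.
Proof. by rewrite /= -quad_norm_leE// ltW. Qed.

Lemma measurable_near_x0 : measurable B. Proof. exact: measurable_ellipsoid. Qed.

Lemma measurable_g_near_x0 : measurable_fun B (fun t => fine (g (row_of t))).
Proof.
have [_ sl _] := hslope; case: gp => _ _ _ [mp _ _] _.
apply: (@measurable_fun_strictly_increasing _ _ _ _ _
  (fun t => direction R m * p (row_of t)) (fun z => direction R m * hr z) (y0 - rho) (y0 + rho)).
- apply: measurable_funM => //; exact: (measurable_funTS mp).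
- move=> t /in_ellipsoidP /quad_norm_lt_outer/g_near[_]; rewrite ler_norml => /andP[? ?].
  by move: rho0 => ?; apply/andP; split; lra.
- by move=> t /in_ellipsoidP Nt; rewrite density_near.
- move=> z z' z1 zz' z2.
  have zr : `|z - y0| <= rho by rewrite ler_norml; apply/andP; split; lra.
  have z'r : `|z' - y0| <= rho by rewrite ler_norml; apply/andP; split; lra.
  have /andP[d1 _] := sl _ _ zr z'r (ltW zz').
  rewrite -subr_gt0 -mulrBr; apply: lt_le_trans d1.
  by rewrite mulr_gt0 ?subr_gt0// divr_gt0.
Qed.

Lemma measurable_bump_norm e del :
  measurable_fun setT (fun t : pt => bump r e del (N (row_of t))).
Proof.
apply: measurableT_comp.
  by apply: continuous_measurable_fun; exact: continuous_bump.
apply: measurableT_comp; last exact: measurable_quad_form.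
exact: (continuous_measurable_fun (@sqrt_continuous R)).
Qed.

Lemma measurable_pert_near e del : 0 <= del -> del <= e -> e <= rho / 4 ->
  measurable_fun B (fun t => pert_density e del (row_of t)).
Proof.
move=> del0 dele erho; have [_ sl _] := hslope; move: (rho0) => rho00.
(* [h] is controlled only within [rho] of [y0]. Clamping its argument gives a function monotone on
   the whole line, hence measurable, which agrees with [h] on the values that occur. *)
pose clamp z := Num.max (y0 - rho) (Num.min z (y0 + rho)).
have clr z : `|clamp z - y0| <= rho.
  rewrite ler_norml lerBrDr lerBlDr; apply/andP; split.
    by rewrite /clamp le_max; apply/orP; left; lra.
  by rewrite /clamp ge_max ge_min; apply/andP; split; [|apply/orP; right]; lra.
have clE z : `|z - y0| <= rho -> clamp z = z.
  rewrite ler_norml => /andP[z1 z2].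
  by rewrite /clamp min_l ?max_r//; lra.
pose k z := direction R m * hr (clamp z).
have k_homo : {homo k : z z' / z <= z'}.
  move=> z z' zz'; rewrite /k -subr_ge0 -mulrBr.
  have czz' : clamp z <= clamp z'.
    rewrite /clamp ge_max; apply/andP; split; first by rewrite le_max lexx.
    by rewrite le_max le_min !ge_min zz' lexx !orbT.
  have /andP[d1 _] := sl _ _ (clr z) (clr z') czz'.
  by apply: le_trans d1; rewrite mulr_ge0 ?subr_ge0// divr_ge0.
have mk : measurable_fun setT (fun z => direction R m * k z).
  by apply: measurable_funM => //; exact: nondecreasing_measurable.
have mgb : measurable_fun B (fun t => fine (g (row_of t)) + bump r e del (N (row_of t))).
  apply: measurable_funD; first exact: measurable_g_near_x0.
  by apply: measurable_funTS; exact: measurable_bump_norm.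
apply: eq_measurable_fun (measurableT_comp mk mgb) => t; rewrite inE => /in_ellipsoidP Nt /=.
have [_ gb] := in_range del0 dele erho Nt.
by rewrite /k clE// mulrA direction_sqr mul1r /pert_density Nt.
Qed.

Lemma measurable_pert_density e del : 0 <= del -> del <= e -> e <= rho / 4 ->
  measurable_fun setT (fun t => pert_density e del (row_of t)).
Proof.
move=> del0 dele erho; case: gp => _ _ _ [mp _ _] _.
have mB := measurable_near_x0; have mBC := measurableC mB.
rewrite -(setvU B); apply/(measurable_funU _ mBC mB).
split; last exact: measurable_pert_near.
apply: eq_measurable_fun (measurable_funTS mp) => t; rewrite inE => /= tB.
rewrite /pert_density ifF//; apply/negP => Nt; exact/tB/in_ellipsoidP.
Qed.

Lemma near_x0_volume_fin : (vol B < +oo)%E.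
Proof. by apply: le_lt_trans (ellipsoid_volume_le x0 Gpos (ltW r0)) _; rewrite ltry. Qed.

Lemma range_bounds z : `|z - y0| <= rho ->
  h0 / 2 <= hr z /\ hr z <= h0 + 2 * a * rho.
Proof.
move=> zr; have [s1 _ _] := hslope; have [_ ?] := s1 _ zr; split => //.
have y00 : `|y0 - y0| <= rho by rewrite subrr normr0 ltW.
have := slope_lipschitz hslope y00 zr.
have : 2 * a * `|z - y0| <= 2 * a * rho by rewrite ler_wpM2l// mulr_ge0.
by have := ler_norm (hr z - h0); lra.
Qed.

(** Nothing changes outside [B], so only the mass inside has to agree; the sign is carried along
    because the balancing argument compares signed densities. *)
Lemma density_of_balance e del : 0 <= del -> del <= e -> e <= rho / 4 ->
  \int[vol]_(t in B) (direction R m * pert_density e del (row_of t)) =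
  \int[vol]_(t in B) (direction R m * p (row_of t)) ->
  density (pert_density e del).
Proof.
move=> del0 dele erho bal; have [_ _ _ [mp p0 p1] _] := gp.
have mq := measurable_pert_density del0 dele erho.
have q0 x : 0 <= pert_density e del x.
  rewrite /pert_density; case: ifP => Nx; last exact: p0.
  have [_ gb] := in_range del0 dele erho Nx.
  by have [+ _] := range_bounds gb; apply: le_trans; rewrite divr_ge0// ltW.
split => //.
have mB := measurable_near_x0; have mBC := measurableC mB.
have iq (f : 'rV[R]_d -> R) : measurable_fun setT (fun t : pt => f (row_of t)) ->
    (forall t, B t -> `|f (row_of t)| <= h0 + 2 * a * rho) ->
    vol.-integrable B (EFin \o (fun t => f (row_of t))).
  move=> mf fM; apply: (bounded_integrable (M := h0 + 2 * a * rho)) => //.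
    exact: near_x0_volume_fin.
  exact: measurable_funTS.
have i1 : vol.-integrable B (EFin \o (fun t => pert_density e del (row_of t))).
  apply: iq => // t /in_ellipsoidP Nt; rewrite ger0_norm// /pert_density Nt.
  have [_ gb] := in_range del0 dele erho Nt.
  by have [] := range_bounds gb.
have i2 : vol.-integrable B (EFin \o (fun t => p (row_of t))).
  apply: iq => // t /in_ellipsoidP Nt; rewrite ger0_norm// density_near//.
  have [ga _] := in_range del0 dele erho Nt.
  by have [] := range_bounds ga.
have {}bal : (\int[vol]_(t in B) (pert_density e del (row_of t))%:E =
    \int[vol]_(t in B) (p (row_of t))%:E)%E.
  rewrite -[LHS]fineK; last exact: integrable_fin_num.
  rewrite -[RHS]fineK; last exact: integrable_fin_num.
  congr EFin; move: bal; rewrite !RintegralZl//; apply: mulfI.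
  by rewrite -normr_eq0 normr_direction oner_eq0.
rewrite -p1 -(setvU B).
have dis : [disjoint ~` B & B] by rewrite disj_set2E setICl.
rewrite !ge0_integral_setU//=; last 4 first.
- by rewrite setvU; exact/measurable_EFinP.
- by move=> t _; rewrite lee_fin.
- by rewrite setvU; exact/measurable_EFinP.
- by move=> t _; rewrite lee_fin.
rewrite bal; congr (_ + _)%E; apply: eq_integral => t; rewrite inE/= => tB.
by rewrite /pert_density ifF//; apply/negP => Nt; exact/tB/in_ellipsoidP.
Qed.

(* Raising [g] near [x0] moves the total mass by at most [2 a e U] in the
   direction of monotonicity; lowering it by [del] on [A] moves the mass back by
   at least [a / 2 * del * v], and continuity in [del] gives total mass one. *)
Lemma exists_density e U v (A : set pt) : 0 < e -> e <= rho / 4 -> 64 * e <= r ^+ 2 ->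
  measurable A -> (forall t, A t -> r / 4 <= N (row_of t) /\ N (row_of t) <= r / 2) ->
  vol A = v%:E -> 0 < v -> 4 * U <= v ->
  (vol [set t | (quad_form G (row_of t - x0) <= (Num.sqrt (2 * e)) ^+ 2)%R] <= U%:E)%E ->
  exists del, [/\ 0 <= del, del <= 4 * e * U / v, del <= e & density (pert_density e del)].
Proof.
move=> e0 erho er mA AN vA v0 Uv EU; move: (r0) (rho0) => r00 rho00.
set E := [set t | _] in EU.
have E2 t : E t <-> N (row_of t) ^+ 2 <= 2 * e.
  by rewrite /E/= sqr_sqrtr ?mulr_ge0 ?(ltW e0)// quad_norm_sqr.
have U0 : 0 <= U by rewrite -lee_fin (le_trans _ EU).
(* The solution of [a / 2 * d1 * v = 2 * a * e * U]; the hypothesis [4 * U <= v] keeps it below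
   [e]. *)
pose d1 := 4 * e * U / v.
have d10 : 0 <= d1 by rewrite divr_ge0 ?mulr_ge0 ?(ltW e0) ?(ltW v0).
have d1e : d1 <= e by rewrite ler_pdivrMr//; nra.
(* [exists_balanced] asks for bounds at every real parameter, so the parameter is truncated to
   [[0, d1]]. *)
pose cl s := Num.max 0 (Num.min s d1).
have cl0 s : 0 <= cl s by rewrite le_max lexx.
have cl1 s : cl s <= d1 by rewrite ge_max d10 ge_min lexx orbT.
have cle s : cl s <= e := le_trans (cl1 s) d1e.
have clE s : 0 <= s <= d1 -> cl s = s.
  by move=> /andP[s0 s1]; rewrite /cl min_l// max_r.
have cll s s' : s <= s' -> cl s <= cl s' /\ cl s' - cl s <= s' - s.
  move=> ss; split.
    by rewrite /cl ge_max le_max lexx/= le_max le_min !ge_min ss lexx !orbT.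
  rewrite lerBlDr /cl ge_max; apply/andP; split.
    by rewrite addr_ge0 ?subr_ge0// le_max lexx.
  have [_|_] := leP s d1.
    have sm : s <= Num.max 0 s by rewrite le_max lexx orbT.
    by rewrite ge_min -[X in X <= _](subrK s) lerD2l sm.
  have dm : d1 <= Num.max 0 d1 by rewrite le_max lexx orbT.
  by rewrite ge_min; apply/orP; right; rewrite -[leLHS]add0r lerD// subr_ge0.
have mB := measurable_near_x0.
pose W s (t : pt) := direction R m * pert_density e (cl s) (row_of t).
pose b (t : pt) := direction R m * p (row_of t).
have dn (z : R) : `|direction R m * z| = `|z| by rewrite normrM normr_direction mul1r.
have [_ _ _ [mp p0 _] _] := gp.
have Wb s t : N (row_of t) <= r -> W s t - b t =
    direction R m * (hr (fine (g (row_of t)) + bump r e (cl s) (N (row_of t)))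
       - hr (fine (g (row_of t)))).
  by move=> Nt; rewrite /W /b -mulrBr density_near// /pert_density Nt.
have [_ sl _] := hslope.
have Wup s t : N (row_of t) <= r -> 0 <= bump r e (cl s) (N (row_of t)) ->
   0 <= W s t - b t <= 2 * a * bump r e (cl s) (N (row_of t)).
  move=> Nt b0; have [ga gb] := in_range (cl0 s) (cle s) erho Nt.
  have := sl _ _ ga gb; rewrite lerDl => /(_ b0); rewrite Wb// addrAC subrr add0r.
  move=> /andP[h1 ->]; rewrite andbT; apply: le_trans h1.
  by rewrite mulr_ge0// divr_ge0.
have Wdown s t : N (row_of t) <= r -> bump r e (cl s) (N (row_of t)) <= 0 ->
   W s t - b t <= a / 2 * bump r e (cl s) (N (row_of t)).
  move=> Nt b0; have [ga gb] := in_range (cl0 s) (cle s) erho Nt.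
  have := sl _ _ gb ga; rewrite gerDl => /(_ b0); rewrite Wb//.
  set z1 := hr (_ + _); set z2 := hr _; set bb := bump _ _ _ _; set gg := fine _.
  move=> /andP[h1 _]; rewrite -lerN2 -mulrN -mulrN opprB.
  by apply: le_trans h1; rewrite opprD addrA subrr add0r.
have cl00 : cl 0 = 0 by rewrite clE// lexx.
have cld1 : cl d1 = d1 by rewrite clE// lexx d10.
have mE : measurable E by exact: measurable_ellipsoid.
have EB : E `<=` B.
  by move=> t /E2; rewrite quad_norm_sqr//= => Et; move: er e0 => ? ?; lra.
have AB : A `<=` B by move=> t /AN[_ Nt]; apply/in_ellipsoidP; lra.
have mW s : measurable_fun B (W s).
  by apply: measurable_funM => //; exact: measurable_pert_near.
have mb : measurable_fun B b.
  by apply: measurable_funM => //; exact: (measurable_funTS mp).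
have ge0_range z : `|z - y0| <= rho -> `|hr z| <= h0 + 2 * a * rho.
  move=> /range_bounds[z1 z2]; rewrite ger0_norm//.
  by apply: le_trans z1; rewrite divr_ge0// ltW.
have WM s t : B t -> `|W s t| <= h0 + 2 * a * rho.
  move=> /in_ellipsoidP Nt; rewrite dn /pert_density Nt; apply: ge0_range.
  by have [_] := in_range (cl0 s) (cle s) erho Nt.
have bM t : B t -> `|b t| <= h0 + 2 * a * rho.
  move=> /in_ellipsoidP Nt; rewrite dn density_near//; apply: ge0_range.
  by have [] := in_range (cl0 0) (cle 0) erho Nt.
have WK s s' t : s <= s' -> B t -> `|W s t - W s' t| <= 2 * a * (s' - s).
  move=> ss /in_ellipsoidP Nt; rewrite -mulrBr dn /pert_density Nt.
  have [_ gb] := in_range (cl0 s) (cle s) erho Nt.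
  have [_ gb'] := in_range (cl0 s') (cle s') erho Nt.
  apply: (le_trans (slope_lipschitz hslope gb' gb)); rewrite ler_wpM2l ?mulr_ge0//.
  have [c1 c2] := cll _ _ ss.
  have b1 := bump_anti r e (N (row_of t)) c1; have b2 := bump_lip r e (N (row_of t)) c1.
  by rewrite opprD addrACA subrr add0r ger0_norm ?subr_ge0//; lra.
have bW t : B t -> b t <= W 0 t.
  move=> /in_ellipsoidP Nt; have := Wup 0 t Nt; rewrite cl00.
  have := bump_ge r e 0 (N (row_of t)); rewrite oppr0 => b0 /(_ b0) /andP[+ _].
  by rewrite subr_ge0.
have Wd1 t : B t -> W d1 t <= b t + (2 * a * e * \1_E t - a / 2 * d1 * \1_A t).
  move=> /in_ellipsoidP Nt; rewrite -lerBlDl.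
  have := Wup d1 t Nt; have := Wdown d1 t Nt; rewrite cld1.
  set bb := bump _ _ _ _ => hd hu.
  have ae0 : 0 <= 2 * a * e by rewrite mulr_ge0 ?(ltW e0)// mulr_ge0.
  (* On [A] the bump is exactly [- d1], and [A] misses [E]. *)
  have [tA|tA] := pselect (A t).
    have [N1 N2] := AN t tA.
    have [bbE Ne] := bump_annulus r0 d10 d1e er N1 N2.
    have tE : ~ E t by move=> /E2; rewrite leNgt Ne.
    rewrite !indicE (mem_set tA) memNset//= mulr1 mulr0 add0r.
    by apply: le_trans (hd _) _; rewrite /bb bbE ?oppr_le0// mulrN.
  rewrite !indicE (memNset tA) mulr0 subr0.
  have [tE|tE] := pselect (E t).
    rewrite (mem_set tE) mulr1.
    have [bb0|/ltW bb0] := leP 0 bb.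
      have /andP[_ h1] := hu bb0; apply: (le_trans h1).
      by rewrite ler_wpM2l ?mulr_ge0//; apply: bump_le => //; exact: ltW.
    apply: (le_trans (hd bb0)); apply: le_trans ae0.
    by rewrite mulr_ge0_le0// divr_ge0.
  rewrite (memNset tE) mulr0.
  have bb0 : bb <= 0.
    apply: bump_le0 => //; rewrite leNgt; apply/negP => Ne; apply/tE/E2; exact: ltW.
  by apply: (le_trans (hd bb0)); rewrite mulr_ge0_le0// divr_ge0.
have fE : fine (vol E) <= U.
  by rewrite -lee_fin fineK// ge0_fin_numE// (le_lt_trans EU)// ltry.
have cEA : 2 * a * e * fine (vol E) <= a / 2 * d1 * fine (vol A).
  apply: (@le_trans _ _ (2 * a * e * U)).
    by rewrite ler_wpM2l// mulr_ge0 ?(ltW e0)// mulr_ge0.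
  rewrite vA /= /d1 le_eqVlt; apply/orP; left; apply/eqP; field.
  by rewrite gt_eqF.
have [del del01 bal] := exists_balanced mB mE mA EB AB near_x0_volume_fin d10 mW mb WM bM WK bW Wd1 cEA.
have /andP[del0 del1] := del01.
have dele : del <= e := le_trans del1 d1e.
exists del; split => //; apply: (density_of_balance del0 dele erho).
by move: bal; rewrite /W clE.
Qed.

Lemma pert_density_eq0 e del x : 0 <= del -> del <= e -> e <= rho / 4 ->
  p x = 0 -> pert_density e del x = 0.
Proof.
move=> del0 dele erho; rewrite /pert_density; case: ifP => // Nx.
rewrite density_near//; have [ga _] := in_range del0 dele erho Nx.
by have [+ _] := range_bounds ga; move=> + g0; rewrite g0 => hh; move: h00 => ?; lra.
Qed.

(** [X] is the integral of [(q - p)^2 / p]. The numerator is at most [4 a^2] times the squared bump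
    and [p >= h0 / 2], hence the factor [8 a^2 / h0]. The squared bump is at most [e^2] on [E] plus
    [del^2] on [B]; the second part is no larger than the first by hypothesis, hence 16. *)
Lemma chi2_density e del U V : 0 <= del -> del <= e -> e <= rho / 4 ->
  (vol [set t | (quad_form G (row_of t - x0) <= (Num.sqrt (2 * e)) ^+ 2)%R] <= U%:E)%E ->
  (vol B <= V%:E)%E -> del ^+ 2 * V <= e ^+ 2 * U -> density (pert_density e del) ->
  exists X, [/\ 0 <= X, X <= 16 * a ^+ 2 / h0 * (e ^+ 2 * U) &
    (\int[vol]_t (pert_density e del (row_of t) ^+ 2 / p (row_of t))%:E = (1 + X)%:E)%E].
Proof.
move=> del0 dele erho EU BV delV [mq q0 q1]; have [_ _ _ [mp p0 p1] _] := gp.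
have e0 : 0 <= e := le_trans del0 dele.
set q := pert_density e del in mq q0 q1 *.
set E := [set t | _] in EU.
have mB := measurable_near_x0.
have mE : measurable E by exact: measurable_ellipsoid.
have E2 t : E t <-> N (row_of t) ^+ 2 <= 2 * e.
  by rewrite /E/= sqr_sqrtr ?mulr_ge0// quad_norm_sqr.
pose kap := 8 * a ^+ 2 / h0.
have kap0 : 0 <= kap by rewrite divr_ge0 ?mulr_ge0 ?sqr_ge0// ltW.
pose D2 x := (q x - p x) ^+ 2 / p x.
have pq x : p x = 0 -> q x = 0 by exact: pert_density_eq0.
have D20 x : 0 <= D2 x by rewrite divr_ge0// sqr_ge0.
have mV : measurable_fun setT (fun t : pt => (p (row_of t))^-1).
  exact: (measurable_fun_invr_ge0 mp (fun=> p0 _)).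
have mD2 : measurable_fun setT (fun t : pt => D2 (row_of t)).
  by apply: measurable_funM => //; apply: measurable_funX; exact: measurable_funB.
have D2le (t : pt) : D2 (row_of t) <= kap * e ^+ 2 * \1_E t + kap * del ^+ 2 * \1_B t.
  set x := row_of t.
  have [Nx|Nx] := leP (N x) r; last first.
    rewrite /D2 /q /pert_density ifN -?ltNge// subrr expr0n mul0r.
    by rewrite addr_ge0// mulr_ge0// mulr_ge0// sqr_ge0.
  have [ga _] := in_range del0 dele erho Nx.
  have [pl _] := range_bounds ga; rewrite -density_near// in pl.
  have p00 : 0 < p x by apply: lt_le_trans pl; rewrite divr_gt0.
  have dq := pert_density_dist del0 dele erho Nx; rewrite -/q in dq.
  set bb := bump r e del (N x) in dq.
  have dq2 : (q x - p x) ^+ 2 <= 4 * a ^+ 2 * bb ^+ 2.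
    rewrite -[(q x - p x) ^+ 2]real_normK ?num_real//.
    rewrite (_ : 4 * a ^+ 2 * bb ^+ 2 = (2 * a * `|bb|) ^+ 2).
      by rewrite ler_sqr ?nnegrE// mulr_ge0// mulr_ge0.
    by rewrite !exprMn (real_normK (num_real bb)); ring.
  have bb2 : bb ^+ 2 <= e ^+ 2 * \1_E t + del ^+ 2 * \1_B t.
    rewrite [in \1_B t]indicE mem_set ?mulr1; last exact/in_ellipsoidP.
    have b1 := bump_ge r e del (N x); have b2 := bump_le r (N x) e0 del0.
    have [bb0|bb0] := leP bb 0.
      apply: (@le_trans _ _ (del ^+ 2)); last by rewrite lerDr mulr_ge0 ?sqr_ge0.
      by rewrite -sqrrN ler_sqr ?nnegrE ?oppr_ge0// lerNl.
    have tE : E t.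
      apply/E2; rewrite leNgt; apply/negP => /ltW/(bump_le0 r del0).
      by rewrite leNgt bb0.
    rewrite indicE mem_set// mulr1; apply: (@le_trans _ _ (e ^+ 2)).
      by rewrite ler_sqr ?nnegrE// ltW.
    by rewrite lerDl sqr_ge0.
  rewrite /D2 ler_pdivrMr//.
  apply: (le_trans dq2); apply: (@le_trans _ _ (kap * bb ^+ 2 * p x)).
    rewrite /kap (_ : _ * p x = 4 * a ^+ 2 * bb ^+ 2 * (2 * p x / h0)); last first.
      by field; rewrite gt_eqF.
    apply: ler_peMr; first by rewrite mulr_ge0 ?sqr_ge0// mulr_ge0// sqr_ge0.
    by rewrite ler_pdivlMr// mul1r mulrC -ler_pdivrMr.
  rewrite ler_wpM2r ?(ltW p00)//.
  by apply: (le_trans (ler_wpM2l kap0 bb2)); rewrite mulrDr !mulrA.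
have mD2E : measurable_fun setT (fun t : pt => (D2 (row_of t))%:E) by exact/measurable_EFinP.
have intD2 : (\int[vol]_t (D2 (row_of t))%:E <= (16 * a ^+ 2 / h0 * (e ^+ 2 * U))%:E)%E.
  have mi (S : set pt) (c : R) : measurable S -> measurable_fun setT (fun t : pt => (c * \1_S t)%:E).
    by move=> mS; apply/measurable_EFinP; apply: measurable_funM => //; exact: measurable_indic.
  have ii (S : set pt) (c W : R) : measurable S -> 0 <= c -> (vol S <= W%:E)%E ->
      (\int[vol]_t (c * \1_S t)%:E <= (c * W)%:E)%E.
    move=> mS c0 SW.
    under eq_integral do rewrite EFinM.
    rewrite ge0_integralZl//; last by apply/measurable_EFinP; exact: measurable_indic.
    by rewrite integral_indic// setIT EFinM lee_wpmul2l// lee_fin.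
  apply: (@le_trans _ _ (\int[vol]_t ((kap * e ^+ 2 * \1_E t)%:E + (kap * del ^+ 2 * \1_B t)%:E))%E).
    apply: ge0_le_integral => //.
    - by move=> t _; rewrite lee_fin.
    - by apply: emeasurable_funD; exact: mi.
    - by move=> t _; rewrite -EFinD lee_fin.
  rewrite ge0_integralD//.
  - apply: (@le_trans _ _ ((kap * e ^+ 2 * U)%:E + (kap * del ^+ 2 * V)%:E)%E).
      by apply: leeD; apply: ii => //; rewrite mulr_ge0// sqr_ge0.
    rewrite -EFinD lee_fin.
    have : kap * (del ^+ 2 * V) <= kap * (e ^+ 2 * U) by rewrite ler_wpM2l.
    by rewrite /kap; lra.
  - by move=> t _; rewrite lee_fin mulr_ge0// mulr_ge0// sqr_ge0.
  - exact: mi.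
  - by move=> t _; rewrite lee_fin mulr_ge0// mulr_ge0// sqr_ge0.
  - exact: mi.
have D2fin : (\int[vol]_t (D2 (row_of t))%:E)%E \is a fin_num.
  rewrite ge0_fin_numE ?(le_lt_trans intD2) ?ltry//.
  by apply: integral_ge0 => t _; rewrite lee_fin.
pose X := fine (\int[vol]_t (D2 (row_of t))%:E)%E.
have XE : (\int[vol]_t (D2 (row_of t))%:E)%E = X%:E by rewrite fineK.
exists X; split.
- by rewrite fine_ge0//; apply: integral_ge0 => t _; rewrite lee_fin.
- by rewrite -lee_fin -XE.
have mw : measurable_fun setT (fun t : pt => (q (row_of t) ^+ 2 / p (row_of t))%:E).
  by apply/measurable_EFinP; apply: measurable_funM => //; exact: measurable_funX.
have w0 x : 0 <= q x ^+ 2 / p x by rewrite divr_ge0// sqr_ge0.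
have mpE : measurable_fun setT (fun t : pt => (p (row_of t))%:E) by exact/measurable_EFinP.
have mqE : measurable_fun setT (fun t : pt => (q (row_of t))%:E) by exact/measurable_EFinP.
(* The identity [q^2 / p + p = (q - p)^2 / p + 2 q] keeps every integrand nonnegative, so no
   integrability has to be known beforehand. *)
have key : (\int[vol]_t (q (row_of t) ^+ 2 / p (row_of t))%:E + 1 = (2 + X)%:E)%E.
  rewrite -[X in (_ + X)%E]p1 -ge0_integralD//; last 2 first.
  - by move=> t _; rewrite lee_fin.
  - by move=> t _; rewrite lee_fin.
  rewrite EFinD -XE (_ : 2%:E = 1 + 1)%E; last by rewrite -EFinD.
  rewrite -q1 -!ge0_integralD//=.
  - apply: eq_integral => t _; rewrite -!EFinD; congr EFin.
    set x := row_of t; have [px|px] := eqVneq (p x) 0.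
      by rewrite /D2 px (pq _ px) expr0n mul0r subrr expr0n mul0r !addr0.
    by rewrite /D2; field.
  - by move=> t _; rewrite -EFinD lee_fin addr_ge0.
  - exact: emeasurable_funD.
  - by move=> t _; rewrite lee_fin.
  - by move=> t _; rewrite lee_fin.
  - by move=> t _; rewrite lee_fin.
move: key; case: (\int[vol]_t _)%E => [s| |]//=.
by rewrite -EFinD => -[sX]; congr EFin; lra.
Qed.

End perturbation.

Lemma exists_annulus_box (R : realType) d (G : 'M[R]_d) (x0 : 'rV[R]_d) (r : R) :
  (0 < d)%N -> posdefmx G -> 0 < r ->
  exists (A : set (d.-tuple (measurableTypeR R))) (v : R),
    [/\ measurable A, lebesgue_measureX R d A = v%:E, 0 < v &
      forall t, A t -> r / 4 <= quad_norm G (row_of t - x0) /\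
        quad_norm G (row_of t - x0) <= r / 2].
Proof.
move=> d0 Gpos r0.
pose o : 'rV[R]_d := const_mx 1.
have No : 0 < quad_norm G o.
  rewrite sqrtr_gt0; apply: Gpos.2; apply/eqP => /rowP/(_ (Ordinal d0)).
  by rewrite !mxE => /eqP; rewrite oner_eq0.
(* A point of norm [3 r / 8], halfway between [r / 4] and [r / 2]; a small box around it stays in
   the annulus. *)
pose w : 'rV[R]_d := x0 + (3 * r / (8 * quad_norm G o)) *: o.
have Nw : quad_norm G (w - x0) = 3 * r / 8.
  rewrite /w addrAC subrr add0r quad_normZ// ger0_norm; last first.
    by rewrite divr_ge0 ?mulr_ge0 ?(ltW r0) ?(ltW No).
  by field; rewrite gt_eqF.
have cN := @continuous_quad_norm _ _ G x0 w.
have : \forall x \near w, r / 4 < quad_norm G (x - x0) < r / 2.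
  have h1 : \forall x \near w, r / 4 < quad_norm G (x - x0).
    by move/cvgr_gt : cN; apply; rewrite Nw; lra.
  have h2 : \forall x \near w, quad_norm G (x - x0) < r / 2.
    by move/cvgr_lt : cN; apply; rewrite Nw; lra.
  by near=> x; apply/andP; split; [near: x|near: x].
move=> /nbhs_boxP[e e0 He].
exists [set t | forall i, `|tnth t i - w ord0 i| <= e / 2], ((2 * (e / 2)) ^+ d).
split.
- exact: measurable_box.
- by rewrite box_volume// divr_gt0.
- by rewrite exprn_gt0// mulr_gt0// divr_gt0.
- move=> t /= tw; have /andP[N1 N2] : r / 4 < quad_norm G (row_of t - x0) < r / 2.
    apply: He => i; rewrite mxE; apply: (le_lt_trans (tw i)); lra.
  by split; exact: ltW.
Unshelve. all: by end_near. Qed.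

Section local_alternatives.
Context (R : realType) (d : nat) (m : monotonicity) (h : \bar R -> \bar R).
Context (g : 'rV[R]_d -> \bar R) (p : 'rV[R]_d -> R) (x0 : 'rV[R]_d).
Context (G : 'M[R]_d) (y0 rho : R).
Local Notation a := `|derive1 (fin_part h) y0|.
Local Notation h0 := (fin_part h y0).
Local Notation vol := (lebesgue_measureX R d).

(* An upper bound for the volume of [quad_form G (x - x0) <= 2 e], the set where
   the perturbation can exceed [g]. *)
Definition ball_bound (e : R) : R := (2 * Num.sqrt (2 * e)) ^+ d / Num.sqrt (\det G).

Lemma ball_bound_small (u : R) : (0 < d)%N -> posdefmx G -> 0 < u ->
  exists2 e0 : R, 0 < e0 & forall e, 0 < e <= e0 -> 0 <= ball_bound e <= u.
Proof.
move=> d0 /posdefmx_det_gt0 detG u0.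
have sdet : 0 < Num.sqrt (\det G) by rewrite sqrtr_gt0.
(* As [t^2 = 8 e], the first bound gives [t <= 1], so that [t^d <= t] for positive [d], and the
   second gives [t <= u * sqrt (det G)]. *)
exists (Num.min (8^-1) (u ^+ 2 * \det G / 8)).
  by rewrite lt_min invr_gt0 ltr0n/= divr_gt0// mulr_gt0// exprn_gt0.
move=> e /andP[e0]; rewrite le_min => /andP[e1 e2].
rewrite /ball_bound; set t := 2 * Num.sqrt (2 * e).
have t0 : 0 <= t by rewrite mulr_ge0// sqrtr_ge0.
have t2 : t ^+ 2 = 8 * e.
  by rewrite /t exprMn sqr_sqrtr ?mulr_ge0 ?(ltW e0)//; ring.
have t1 : t <= 1.
  by rewrite -(@ler_sqr _ t 1) ?nnegrE// t2 expr1n; lra.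
rewrite divr_ge0 ?exprn_ge0 ?(ltW sdet)//= ler_pdivrMr//.
apply: (@le_trans _ _ t); first by rewrite ler_iXnr.
rewrite -ler_sqr ?nnegrE ?mulr_ge0 ?(ltW u0) ?(ltW sdet)//.
by rewrite t2 exprMn sqr_sqrtr ?(ltW detG)//; lra.
Qed.

Lemma local_alternatives : (0 < d)%N -> represents m h g p -> relint (dom g) x0 ->
  g x0 = y0%:E -> 0 < rho -> slope_controlled m h y0 rho -> 0 < h0 -> 0 < a ->
  SC g x0 G ->
  exists2 e0 : R, 0 < e0 & forall e, 0 < e <= e0 ->
    exists (q : 'rV[R]_d -> R) (f : 'rV[R]_d -> \bar R) (X : R),
      [/\ represents m h f q /\ f x0 = (y0 + e)%:E, e < rho,
          forall x, p x = 0 -> q x = 0,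
          0 <= X <= 16 * a ^+ 2 / h0 * (e ^+ 2 * ball_bound e) &
          (\int[vol]_t (q (row_of t) ^+ 2 / p (row_of t))%:E = (1 + X)%:E)%E].
Proof.
move=> d0 gp gri gx0 rho0 hslope h00 a0 [Gpos [qc [cqc gdec]]].
have [[cpg domg] _ _ _ _] := gp.
have gfin := relint_dom_near (conj cpg domg) gri.
have rho20 : 0 < rho / 2 by lra.
have gnear := closed_proper_convex_near cpg gx0 gfin rho20.
have /nbhs_boxP[eta eta0 Heta] : \forall x \near x0,
    (g x = (fine (g x))%:E /\ `|fine (g x) - y0| <= rho / 2) /\
    g x = ((2^-1 * quad_form G (x - x0))%:E + qc x)%E.
  by near=> x; split; [near: x|near: x].
have [K K0 HK] := coord_le_quad_norm Gpos.
(* An ellipsoid inside the box on which all local properties of [g] hold. *)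
pose r1 := eta / K; have r10 : 0 < r1 by rewrite divr_gt0.
have Hr1 x : quad_norm G (x - x0) < r1 ->
    (g x = (fine (g x))%:E /\ `|fine (g x) - y0| <= rho / 2) /\
    g x = ((2^-1 * quad_form G (x - x0))%:E + qc x)%E.
  move=> Nx; apply: Heta => i; have := HK (x - x0) i; rewrite !mxE => /le_lt_trans; apply.
  by rewrite mulrC -ltr_pdivlMr.
pose r := r1 / 2; have r0 : 0 < r by rewrite divr_gt0.
have rr1 : r < r1 by rewrite /r; lra.
have [A [v [mA vA v0 AN]]] := exists_annulus_box x0 d0 Gpos r0.
have sdet : 0 < Num.sqrt (\det G) by rewrite sqrtr_gt0 posdefmx_det_gt0.
pose V := (2 * r) ^+ d / Num.sqrt (\det G).
have V0 : 0 <= V := divr_ge0 (exprn_ge0 _ (mulr_ge0 (ler0n _ 2) (ltW r0))) (ltW sdet).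
have volB := ellipsoid_volume_le x0 Gpos (ltW r0).
(* The first bound lets the annulus compensate with [del <= e]. The second gives
   [16 * U * V <= v^2], which makes the divergence on the annulus at most that on the small
   ellipsoid; [V + 1] avoids a zero denominator. *)
pose u := Num.min (v / 4) (v ^+ 2 / (16 * (V + 1))).
have V10 : 0 < 16 * (V + 1) by rewrite mulr_gt0// ltr_wpDl.
have u0 : 0 < u by rewrite lt_min !divr_gt0// exprn_gt0.
have [e1 e10 He1] := ball_bound_small d0 Gpos u0.
exists (Num.min e1 (Num.min (r ^+ 2 / 64) (rho / 4))).
  by rewrite !lt_min e10 !divr_gt0// exprn_gt0.
move=> e /andP[e0]; rewrite !le_min => /and3P[ee1 er erho].
have /andP[U0 Uu] : 0 <= ball_bound e <= u by apply: He1; rewrite e0.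
set U := ball_bound e in U0 Uu *.
have EU : (vol [set t | (quad_form G (row_of t - x0) <= (Num.sqrt (2 * e)) ^+ 2)%R] <= U%:E)%E.
  by apply: ellipsoid_volume_le => //; exact: sqrtr_ge0.
move: Uu; rewrite le_min => /andP[Uv UV].
have gn x (Nx : quad_norm G (x - x0) < r1) := (Hr1 x Nx).1.
have gd x (Nx : quad_norm G (x - x0) < r1) := (Hr1 x Nx).2.
have er64 : 64 * e <= r ^+ 2 by lra.
have Uv4 : 4 * U <= v by lra.
have [del [del0 del1 dele dq]] := exists_density Gpos gp hslope rho0 r0 rr1 h00 a0 gn
  e0 erho er64 mA AN vA v0 Uv4 EU.
have er2 : 2 * e <= r ^+ 2 by lra.
have delV : del ^+ 2 * V <= e ^+ 2 * U.
  have d2 : del ^+ 2 <= (4 * e * U / v) ^+ 2.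
    by rewrite ler_sqr ?nnegrE// (le_trans del0).
  apply: (le_trans (ler_wpM2r V0 d2)).
  have -> : (4 * e * U / v) ^+ 2 * V = e ^+ 2 * U * (16 * U * V / v ^+ 2).
    by field; rewrite gt_eqF.
  apply: ler_piMr; first by rewrite mulr_ge0 ?sqr_ge0.
  rewrite ler_pdivrMr ?exprn_gt0// mul1r.
  move: UV; rewrite ler_pdivlMr// => UV; nra.
have [X [X0 X1 XE]] := chi2_density Gpos gp hslope rho0 r0 rr1 h00 gn del0 dele erho
  EU volB delV dq.
exists (pert_density h g p x0 G r e del), (pert_fun g x0 G r e del), X.
split => //.
- split; last exact: pert_fun_x0.
  exact: (pert_represents Gpos gp hslope rho0 r0 rr1 cqc gn gd del0 dele erho er2 dq).
- by lra.
- move=> x; exact: (pert_density_eq0 gp hslope rho0 rr1 h00 gn del0 dele erho).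
- by rewrite X0.
Unshelve. all: by end_near. Qed.

End local_alternatives.

(** * The rate and the choice of the sequence *)

Lemma exprD1_le2 (R : realType) (X : R) n : 0 <= X -> n%:R * X <= 2^-1 ->
  (1 + X) ^+ n <= 2.
Proof.
move=> X0 nX.
(* A reversed Bernoulli inequality; with [n X <= 1/2] the second factor is at least one half. *)
have bernoulli k : (1 + X) ^+ k * (1 - k%:R * X) <= 1.
  elim: k => [|k IH]; first by rewrite expr0 mul0r subr0 mulr1.
  apply: le_trans IH; rewrite exprS [_ * (1 + X) ^+ k]mulrC -mulrA.
  rewrite ler_wpM2l ?exprn_ge0 ?addr_ge0//.
  have := mulr_ge0 (ler0n R k.+1) (sqr_ge0 X); rewrite -natr1; nra.
have b1 := bernoulli n.
have Xn0 : 0 <= (1 + X) ^+ n by rewrite exprn_ge0// addr_ge0.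
have : (1 + X) ^+ n * 2^-1 <= (1 + X) ^+ n * (1 - n%:R * X) by rewrite ler_wpM2l//; lra.
lra.
Qed.

Lemma limn_einf_ge (R : realType) (u : (\bar R)^nat) (l : \bar R) N :
  (forall n, (N <= n)%N -> (l <= u n)%E) -> (l <= limn_einf u)%E.
Proof.
move=> lu; rewrite limn_einf_lim; apply: lime_ge; first exact: is_cvg_einfs.
exists N => // n /= Nn; apply: le_ereal_inf_tmp => _ /= [k nk <-].
by apply: lu; exact: leq_trans nk.
Qed.

(* For each [n] the element [q_ n] is as good as possible for the largest integer
   bound [k <= n] that can be met at time [n]. *)
Lemma exists_diverging_sequence (R : realType) (Q : Type) (S : Q -> Prop)
    (u : nat -> Q -> \bar R) (q0 : Q) : S q0 ->
  (forall M : R, exists N, forall n, (N <= n)%N -> exists q, S q /\ (M%:E <= u n q)%E) ->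
  exists q_ : nat -> Q, (forall n, S (q_ n)) /\
    forall M : R, exists N, forall n, (N <= n)%N -> (M%:E <= u n (q_ n))%E.
Proof.
move=> S0 Su.
have best n K : exists q, S q /\ forall k, (k <= K)%N ->
    (exists q', S q' /\ (k%:R%:E <= u n q')%E) -> (k%:R%:E <= u n q)%E.
  elim: K => [|K [q [Sq Hq]]].
    have [[q' [Sq' uq']]|no] := pselect (exists q', S q' /\ (0%:R%:E <= u n q')%E).
      by exists q'; split => // k; rewrite leqn0 => /eqP->.
    by exists q0; split => // k; rewrite leqn0 => /eqP-> /no.
  have [[q' [Sq' uq']]|no] := pselect (exists q', S q' /\ (K.+1%:R%:E <= u n q')%E).
    exists q'; split => // k kK _; apply: le_trans uq'.
    by rewrite lee_fin ler_nat.
  exists q; split => // k; rewrite leq_eqVlt => /predU1P[-> /no//|].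
  by rewrite ltnS; exact: Hq.
have /choice[q_ Hq_] : forall n, exists q, S q /\ forall k, (k <= n)%N ->
    (exists q', S q' /\ (k%:R%:E <= u n q')%E) -> (k%:R%:E <= u n q)%E.
  by move=> n; exact: best.
exists q_; split=> [n|M]; first by have [] := Hq_ n.
pose k := (Num.truncn M).+1.
have Mk : M <= k%:R by rewrite ltW// truncnS_gt.
have [N HN] := Su k%:R.
exists (maxn N k) => n; rewrite geq_max => /andP[Nn kn].
have [_ Hn] := Hq_ n; apply: (@le_trans _ _ k%:R%:E); first by rewrite lee_fin.
by apply: Hn => //; exact: HN.
Qed.

Section rate.
Context (R : realType) (d : nat).
Local Notation theta := ((d + 4)%:R^-1 : R).

Lemma powR_theta (x : R) : 0 <= x -> (x `^ theta) ^+ (d + 4) = x.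
Proof.
move=> x0; rewrite -powR_mulrn ?powR_ge0// -powRrM mulVf ?powRr1//.
Qed.

Lemma natr_powR_theta n : n%:R `^ (2 / (d + 4)%:R) = (n%:R ^+ 2) `^ theta.
Proof. by rewrite powRrM -powR_mulrn. Qed.

(** Squaring removes the roots: [16^2] and the [8^d] from the volume bound appear, and the divisor
    [4^5 * 8^d] is chosen so that the square is exactly [1/4], as [256 * 4 = 4^5]. *)
Lemma chi2_rate (G : 'M[R]_d) (h0 a e : R) n : posdefmx G -> 0 < h0 -> 0 < a ->
  (0 < n)%N -> 0 < e ->
  e ^+ (d + 4) = h0 ^+ 2 / a ^+ 4 * \det G / (4 ^+ 5 * 8 ^+ d) / n%:R ^+ 2 ->
  n%:R * (16 * a ^+ 2 / h0 * (e ^+ 2 * ball_bound G e)) <= 2^-1.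
Proof.
move=> /posdefmx_det_gt0 detG h00 a0 n0 e0 eE.
have n0r : 0 < n%:R :> R by rewrite ltr0n.
have sdet : 0 < Num.sqrt (\det G) by rewrite sqrtr_gt0.
have e20 : 0 <= 2 * e by rewrite mulr_ge0// ltW.
have d8 : 0 < 8 ^+ d :> R by rewrite exprn_gt0.
have U2 : ball_bound G e ^+ 2 = 8 ^+ d * e ^+ d / \det G.
  rewrite /ball_bound expr_div_n sqr_sqrtr ?(ltW detG)// -exprM mulnC exprM.
  have -> : (2 * Num.sqrt (2 * e)) ^+ 2 = 8 * e by rewrite exprMn sqr_sqrtr//; ring.
  by rewrite exprMn.
have U0 : 0 <= ball_bound G e.
  by rewrite divr_ge0 ?(ltW sdet)// exprn_ge0// mulr_ge0// sqrtr_ge0.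
rewrite -ler_sqr ?nnegrE; last 2 first.
- have c0 : 0 <= 16 * a ^+ 2 / h0.
    exact: divr_ge0 (mulr_ge0 (ler0n _ 16) (sqr_ge0 a)) (ltW h00).
  exact: mulr_ge0 (ler0n _ n) (mulr_ge0 c0 (mulr_ge0 (sqr_ge0 e) U0)).
- by rewrite invr_ge0.
have -> : (n%:R * (16 * a ^+ 2 / h0 * (e ^+ 2 * ball_bound G e))) ^+ 2 =
   n%:R ^+ 2 * (256 * a ^+ 4 / h0 ^+ 2) * (e ^+ 4 * ball_bound G e ^+ 2).
  by field; rewrite gt_eqF.
rewrite U2.
have -> : e ^+ 4 * (8 ^+ d * e ^+ d / \det G) = 8 ^+ d * e ^+ (d + 4) / \det G.
  by rewrite exprD; ring.
rewrite eE le_eqVlt; apply/orP; left; apply/eqP; field.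
by rewrite !gt_eqF.
Qed.

End rate.

(** * The lower bound *)

Section risk_of_perturbations.
Context (R : realType) (d : nat) (m : monotonicity) (h : \bar R -> \bar R).
Context (g : 'rV[R]_d -> \bar R) (p : 'rV[R]_d -> R) (x0 : 'rV[R]_d).
Context (y0 rho : R).
Local Notation a := `|derive1 (fin_part h) y0|.
Local Notation h0 := (fin_part h y0).
Local Notation theta := ((d + 4)%:R^-1 : R).
Hypothesis d0 : (0 < d)%N.
Hypothesis gp : represents m h g p.
Hypothesis gri : relint (dom g) x0.
Hypothesis gx0 : g x0 = y0%:E.
Hypothesis rho0 : 0 < rho.
Hypothesis hslope : slope_controlled m h y0 rho.
Hypotheses (h00 : 0 < h0) (a0 : 0 < a).

(* The functional T: the level [y] is determined by [h y], as [h] is strictly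
   monotone near [y0]. *)
Definition value_at (q : 'rV[R]_d -> R) : R :=
  fine (xget 0%E [set y : \bar R | h y = (q x0)%:E]).

Definition close_alternative (q : 'rV[R]_d -> R) : Prop :=
  exists f z, [/\ represents m h f q, f x0 = z%:E & `|z - y0| < rho].

Lemma x0_in_density_domain : density_domain m x0.
Proof. by case: gp => admg _ _ _ _; apply: (relint_density_domain admg); rewrite gx0 ltry. Qed.

Lemma value_atE q f z : represents m h f q -> f x0 = z%:E -> `|z - y0| < rho ->
  value_at q = z.
Proof.
move=> [_ qE _ _ _] fx0 zr; have [_ _ inj] := hslope.
have qx0 : (q x0)%:E = h z%:E by rewrite qE ?fx0//; exact: x0_in_density_domain.
rewrite /value_at; case: xgetP => [y _ /= hy|/(_ z%:E)]; last by rewrite /= qx0.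
by have -> := inj z y zr (etrans hy qx0).
Qed.

Lemma close_alternative_p : close_alternative p.
Proof. by exists g, y0; rewrite subrr normr0. Qed.

(** [evaluation_on] concerns every representation of [q], whereas [close_alternative] supplies one;
    the injectivity clause carries the value over to the others. *)
Lemma close_alternative_evaluation (Q : set ('rV[R]_d -> R)) :
  (forall q, Q q -> close_alternative q) -> evaluation_on m h x0 Q value_at.
Proof.
move=> Qclose q f /Qclose[f' [z [qf' f'x0 zr]]] qf.
have [_ _ inj] := hslope; have [_ qE _ _ _] := qf; have [_ qE' _ _ _] := qf'.
rewrite (value_atE qf' f'x0 zr); apply: (inj _ _ zr).
have dx0 := x0_in_density_domain.
by rewrite -qE// qE'// f'x0.
Qed.

(** With [e = (K / n^2)^(1/(d + 4))] the divergence stays below [1 / (2 n)], and the power of [n]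
    cancels in the bound [e / 4]. The threshold [N] depends on [G]. *)
Lemma eventually_risk_ge (G : 'M[R]_d) : SC g x0 G ->
  exists N, forall n, (N <= n)%N -> exists q, close_alternative q /\
    (((h0 ^+ 2 / a ^+ 4 * \det G / (4 ^+ 5 * 8 ^+ d)) `^ theta / 4)%:E <=
     (n%:R `^ (2 / (d + 4)%:R))%:E * minimax_risk n value_at [set p; q])%E.
Proof.
move=> SCG; have [Gpos _] := SCG; have detG := posdefmx_det_gt0 Gpos.
have [e0 e00 He0] := local_alternatives d0 gp gri gx0 rho0 hslope h00 a0 SCG.
set K := h0 ^+ 2 / a ^+ 4 * \det G / (4 ^+ 5 * 8 ^+ d).
have K0 : 0 < K.
  have M0 : 0 < 4 ^+ 5 * 8 ^+ d :> R by rewrite mulr_gt0// exprn_gt0.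
  by rewrite divr_gt0// mulr_gt0// divr_gt0// exprn_gt0.
(* Since [N <= n <= n^2], this makes [K / n^2] at most the power of [e0]. *)
pose N := (Num.truncn (K / e0 ^+ (d + 4))).+1.
exists N => n Nn.
have n0 : (0 < n)%N by exact: leq_trans Nn.
have n0r : 0 < n%:R :> R by rewrite ltr0n.
have n20 : 0 < n%:R ^+ 2 :> R by rewrite exprn_gt0.
pose e := (K / n%:R ^+ 2) `^ theta.
have e_gt0 : 0 < e by rewrite powR_gt0// divr_gt0.
have eE : e ^+ (d + 4) = K / n%:R ^+ 2 by rewrite /e powR_theta// divr_ge0// ltW.
have ee0 : e <= e0.
  rewrite -(@ler_pXn2r _ (d + 4)) ?nnegrE ?(ltW e_gt0) ?(ltW e00)//; last first.
    by rewrite addnS.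
  rewrite eE ler_pdivrMr// -ler_pdivrMl ?exprn_gt0// mulrC.
  apply: (@le_trans _ _ N%:R); first by rewrite ltW// truncnS_gt.
  by rewrite -natrX ler_nat (leq_trans Nn)// leq_pmulr.
have [|q [f [X [[qf fx0] erho pq /andP[X0 X1] XE]]]] := He0 e; first by rewrite e_gt0.
have er : `|y0 + e - y0| < rho by rewrite addrAC subrr add0r gtr0_norm.
exists q; split; first by exists f, (y0 + e).
have [_ _ _ dp _] := gp; have [_ _ _ dq _] := qf.
have nX : n%:R * X <= 2^-1.
  apply: le_trans (chi2_rate Gpos h00 a0 n0 e_gt0 eE).
  by rewrite ler_wpM2l ?(ltW n0r).
have := minimax_risk_two_point value_at dp dq pq XE (exprD1_le2 X0 nX).
rewrite (value_atE qf fx0 er) (value_atE gp gx0) ?subrr ?normr0//.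
rewrite opprD addrA subrr add0r normrN gtr0_norm// => risk.
rewrite natr_powR_theta.
have -> : K `^ theta / 4 = (n%:R ^+ 2) `^ theta * (e / 4).
  rewrite /e mulrA -powRM ?(ltW n20)//; last by rewrite divr_ge0// ltW.
  by rewrite [_ * (K / _)]mulrC divfK// gt_eqF.
by rewrite EFinM lee_wpmul2l// lee_fin powR_ge0.
Qed.

End risk_of_perturbations.

Theorem theorem2p23 (R : realType) (d : nat) (d_gt0 : (0 < d)%N) :
  exists2 C : R, 0 < C &
  forall (m : monotonicity) (h : \bar R -> \bar R) (g : 'rV[R]_d -> \bar R)
         (p : 'rV[R]_d -> R) (x0 : 'rV[R]_d),
    transformation m d h ->
    represents m h g p ->
    relint (dom g) x0 ->
    C1_at h (fine (g x0)) ->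
    (0 < h (g x0))%E ->
    derive1 (fin_part h) (fine (g x0)) != 0 ->
    (0 < curv g x0)%E ->
    exists (p_ : nat -> 'rV[R]_d -> R) (T : ('rV[R]_d -> R) -> R),
      [/\ forall n, Pclass m h (p_ n),
          evaluation_on m h x0 ([set p] `|` range p_) T
        & (C%:E *
           (((fine (h (g x0))) ^+ 2 / (derive1 (fin_part h) (fine (g x0))) ^+ 4)%:E
            * curv g x0) `^ ((d + 4)%:R^-1)
           <= limn_einf (fun n => (n%:R `^ (2 / (d + 4)%:R))%:E
                                  * minimax_risk n T [set p; p_ n]))%E].
Proof.
pose theta : R := (d + 4)%:R^-1.
have theta0 : 0 < theta by rewrite invr_gt0 ltr0n addnS.
pose M : R := 4 ^+ 5 * 8 ^+ d.
have M0 : 0 < M by rewrite mulr_gt0// exprn_gt0.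
(* [M] is the divisor in [chi2_rate]. The factor 2 pays for a matrix whose determinant exceeds only
   half of a finite supremum; the 4 is that of the two-point bound. *)
exists ((2 * M)^-1 `^ theta / 4).
  by rewrite divr_gt0// powR_gt0// invr_gt0 mulr_gt0.
move=> m h g p x0 th gp gri hC1 hpos hn0 gcurv.
have [[cpg domg] pE _ _ _] := gp; have [_ [gN _] _] := cpg.
set y0 := fine (g x0) in hC1 hn0 *.
have gx0 : g x0 = y0%:E.
  rewrite fineK// fin_numE gN/= lt_eqF//.
  by case: gri.
rewrite gx0 in hpos *.
have [rho rho0 hslope] := slope_controlled_near th hC1 hpos hn0.
set h0 := fine (h y0%:E); set b := derive1 (fin_part h) y0 in hn0 *.
have h00 : 0 < h0.
  by rewrite -lte_fin /h0 fineK//; have [] := nbhs_singleton hC1.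
have a0 : 0 < `|b| by rewrite normr_gt0.
have b4 : b ^+ 4 = `|b| ^+ 4 by rewrite -normrX ger0_norm// exprn_even_ge0.
pose k := h0 ^+ 2 / b ^+ 4.
have k0 : 0 < k by rewrite /k b4 divr_gt0// exprn_gt0.
pose S := close_alternative m h x0 y0 rho.
pose T := value_at h x0.
pose r n q := ((n%:R `^ (2 / (d + 4)%:R))%:E * minimax_risk n T [set p; q])%E.
have Sp : S p by exact: (close_alternative_p gp gx0 rho0).
have risk (G : 'M[R]_d) : SC g x0 G -> exists N, forall n, (N <= n)%N ->
    exists q, S q /\ (((k * \det G / M) `^ theta / 4)%:E <= r n q)%E.
  move=> SCG; have := eventually_risk_ge d_gt0 gp gri gx0 rho0 hslope h00 a0 SCG.
  by rewrite -b4.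
suff [p_ [Sp_ lim]] : exists p_ : nat -> 'rV[R]_d -> R, (forall n, S (p_ n)) /\
    (((2 * M)^-1 `^ theta / 4)%:E * (k%:E * curv g x0) `^ theta
      <= limn_einf (fun n => r n (p_ n)))%E.
  exists p_, T; split => //.
  - by move=> n; have [f [z [qf _ _]]] := Sp_ n; exists f.
  - apply: (close_alternative_evaluation gp gx0 hslope) => q [->//|[n _ <-]].
    exact: Sp_.
move: gcurv; rewrite /curv; case: asboolP => [SC0|]; last by rewrite ltxx.
set s := ereal_sup _ => s0.
have SCdet (c : R) : (c%:E < s)%E -> exists2 G, SC g x0 G & c < \det G.
  by move=> /ereal_sup_gt[_ [G SCG <-]]; rewrite lte_fin; exists G.
have [sfin|] := boolP (s \is a fin_num).
  have sE : s = (fine s)%:E by rewrite fineK.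
  have fs0 : 0 < fine s by rewrite -lte_fin -sE.
  have [|G SCG detG] := SCdet (fine s / 2).
    by rewrite [ltRHS]sE lte_fin; lra.
  have [N HN] := risk G SCG.
  (* One matrix serves all [n]; below its threshold [p] itself fills the sequence. *)
  have /choice[p_ Hp_] : forall n, exists q, S q /\
      ((N <= n)%N -> (((k * \det G / M) `^ theta / 4)%:E <= r n q)%E).
    move=> n; have [/HN[q [Sq rq]]|nN] := leqP N n; first by exists q.
    by exists p; split.
  exists p_; split=> [n|]; first by have [] := Hp_ n.
  apply: (@le_trans _ _ ((k * \det G / M) `^ theta / 4)%:E); last first.
    by apply: (@limn_einf_ge _ _ _ N) => n nN; have [_] := Hp_ n; apply.
  have -> : (k%:E * s = (k * fine s)%:E)%E by rewrite [RHS]EFinM fineK.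
  have M20 : 0 <= (2 * M)^-1 by rewrite invr_ge0 ltW// mulr_gt0.
  have ks0 : 0 <= k * fine s := mulr_ge0 (ltW k0) (ltW fs0).
  rewrite poweR_EFin -EFinM lee_fin mulrAC ler_pM2r// -powRM//.
  apply: ge0_ler_powR; rewrite ?nnegrE ?(ltW theta0)//.
  - exact: mulr_ge0.
  - by apply: divr_ge0 (ltW M0); apply: mulr_ge0; [exact: ltW|lra].
  rewrite ler_pdivlMr//.
  have -> : (2 * M)^-1 * (k * fine s) * M = k * (fine s / 2).
    by field; rewrite gt_eqF.
  by rewrite ler_pM2l// ltW.
rewrite ge0_fin_numE ?(ltW s0)// -leNgt leye_eq => /eqP sy.
have [|p_ [Sp_ Hp_]] := @exists_diverging_sequence R _ S r p Sp.
  (* A determinant this large makes the normalised risk at least [c' / 4 = |c| + 1], which exceeds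
     [c]. *)
  move=> c; pose c' := 4 * (`|c| + 1).
  have c'0 : 0 < c' by rewrite mulr_gt0// ltr_wpDl.
  have [|G SCG detG] := SCdet (c' ^+ (d + 4) * M / k); first by rewrite sy ltry.
  have [N HN] := risk G SCG; exists N => n /HN[q [Sq rq]]; exists q; split => //.
  apply: le_trans rq; rewrite lee_fin.
  have cG : c' ^+ (d + 4) <= k * \det G / M.
    rewrite ler_pdivlMr// [leRHS]mulrC -ler_pdivrMr//; exact: ltW.
  have c'G : c' <= (k * \det G / M) `^ theta.
    rewrite -(@ler_pXn2r _ (d + 4)) ?nnegrE ?powR_ge0 ?(ltW c'0)//; last by rewrite addnS.
    by rewrite powR_theta// (le_trans _ cG)// exprn_ge0// ltW.
  by rewrite ler_pdivlMr//; have := ler_norm c; rewrite /c' in c'G; lra.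
exists p_; split => //.
have -> : limn_einf (fun n => r n (p_ n)) = +oo%E; last by rewrite leey.
apply/eq_infty => c; have [N HN] := Hp_ c.
exact: limn_einf_ge HN.
Qed.
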